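(* Let $G$ be a countable locally finite abelian group (written additively) such that $2G=\{2g:g\in G\}$ is infinite. Let $G_\bullet=(G_i)_{i\ge 1}$ be an arbitrary filtration of $G$ by finite subgroups, i.e. $G_1\le G_2\le\cdots$ are finite subgroups with $\bigcup_{i\ge1}G_i=G$. Then for all real numbers $0\le\alpha\le\beta\le1$ there exists a set $A\subseteq G$ such that $$\mathcal L_{G_\bullet}(A)=[\alpha,\beta].$$
   Context: An abelian group is locally finite if every finitely generated subgroup is finite. For a subset $A$ of an additive abelian group $G$, $\mathcal P(A):=\{\sum_{a\in F}a : F\subseteq A,\ |F|<\infty\}$ is the set of finite subset sums (sums of distinct elements of $A$), including the empty sum, so $0\in\mathcal P(A)$. For a filtration $G_\bullet=(G_i)_{i\ge1}$ and $S\subseteq G$, put $d_i^{G_\bullet}(S):=|S\cap G_i|/|G_i|$. The set $\mathcal L_{G_\bullet}(A)$ is the set of all subsequential limits of $\bigl(d_i^{G_\bullet}(\mathcal P(A))\bigr)_{i\ge1}$, that is, all $\gamma\in[0,1]$ such that $\lim_{\ell\to\infty}d_{i_\ell}^{G_\bullet}(\mathcal P(A))=\gamma$ for some $i_1<i_2<\cdots$. *)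

(* Defs.v *)
From HB Require Import structures.
From mathcomp Require Import all_boot all_order all_algebra finmap.
From mathcomp Require Import all_classical all_reals all_analysis.
Set Implicit Arguments.
Unset Strict Implicit.
Unset Printing Implicit Defensive.
Import Order.TTheory GRing.Theory Num.Theory.
Import numFieldNormedType.Exports.
Local Open Scope classical_set_scope.
Local Open Scope ring_scope.

Definition subgroup (G : zmodType) (H : set G) : Prop := zmod_closed [in H].

Definition generated (G : zmodType) (S : set G) : set G :=
  smallest (@subgroup G) S.

Definition locally_finite_group (G : zmodType) : Prop :=
  forall S : set G, finite_set S -> finite_set (generated S).

(* Indexed from 0 instead of 1, i.e. [H i] is the subgroup $G_{i+1}$. *)
Definition finite_filtration (G : zmodType) (H : nat -> set G) : Prop :=
  [/\ forall i, subgroup (H i),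
      forall i, finite_set (H i),
      forall i, H i `<=` H i.+1
    & \bigcup_i H i = [set: G]].

Definition subset_sums (G : zmodType) (A : set G) : set G :=
  [set x | exists F : {fset G}, [set` F] `<=` A /\ x = \sum_(a <- F) a].

(* [fset_set] is only meaningful on finite sets; [H i] is finite whenever
   [H] is a [finite_filtration]. *)
Definition rel_density (R : realType) (G : zmodType) (H : nat -> set G)
    (S : set G) (i : nat) : R :=
  #|` fset_set (S `&` H i)|%:R / #|` fset_set (H i)|%:R.

Definition limit_densities (R : realType) (G : zmodType) (H : nat -> set G)
    (A : set G) : set R :=
  [set c : R | 0 <= c <= 1 /\
    exists phi : nat -> nat, {homo phi : m n / (m < n)%N} /\
      rel_density R H (subset_sums A) (phi l) @[l --> \oo] --> c].

Arguments limit_densities R {G} H A.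

(* Main.v *)
(** A finite list [s] in [Gf n] determines the set [X = ssums s] of its subset sums, and the
    list is enlarged along the filtration without changing [X] inside [Gf n], while the
    density moves by small steps, down to [alpha] and up to [beta] infinitely often.

    Let [t] be in [N = Gf n] and let [o], [z] be such that [P = ssums o] and [z + P] together
    form a transversal of [N] in a larger subgroup. Adjoining [o] and [z + t] puts a translate
    of [X], of [t + X] or of [X] united with [t + X] in each coset of [N]. If [- z] is not in
    [P], then nothing changes inside [N], the union appears on a positive proportion of the
    cosets, and repeating this brings the density close to that of the union: this is an
    up-move. To move down, adjoin first a list whose subset sums [P] miss only a small part of
    a transversal made of [P] and [t + P], and then make up for the loss in the subgroup
    reached so far by putting the union there, but only a single translate on a positive
    proportion of the other cosets. Up-moves with the same [t] later recover this loss, so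
    that small losses add up to any decrease, and all of them can be undone in small steps.

    The required [o] and [z] are built from multiples of an element whose order modulo [N] is
    at least 3; it exists as [2 G] is infinite. Missing only a small part requires either
    large orders modulo [N], or the iteration of up-moves inside a complement of [N]. *)
Require Import Defs.
From HB Require Import structures.
From mathcomp Require Import all_boot all_order all_algebra finmap.
From mathcomp Require Import all_classical all_reals all_analysis.
From mathcomp Require Import zify ring lra.
Set Implicit Arguments.
Unset Strict Implicit.
Unset Printing Implicit Defensive.
Import Order.TTheory GRing.Theory Num.Theory.
Import numFieldNormedType.Exports.
Local Open Scope classical_set_scope.
Local Open Scope ring_scope.

(** * Subset sums and cosets of finite subgroups *)

Section Sumsets.
Variable G : zmodType.
Implicit Types (A B C N M X Y Z : {fset G}) (x y z t g : G) (s o : seq G).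

Definition addfs A B : {fset G} := [fset (a + b)%R | a in A, b in B]%fset.

Definition trfs x A : {fset G} := [fset (x + a)%R | a in A]%fset.

(** Taken on lists, so that adjoining elements is concatenation; on a duplicate-free list these are
    the subset sums of its set of entries. *)
Fixpoint ssums s : {fset G} :=
  if s is x :: s' then (ssums s' `|` trfs x (ssums s'))%fset else [fset 0]%fset.

Definition fin_subgroup N := 0 \in N /\ {in N &, forall x y, x - y \in N}.

(** The slice of [Z] in the coset [y + N], moved back into [N] so that slices over different cosets
    can be compared. *)
Definition fib N Z y : {fset G} := [fset u in N | (y + u)%R \in Z]%fset.

(** A transversal of [N] in [M], normalised so that [N] itself is represented by 0. *)
Definition coset_reps N M Y :=
  [/\ {subset Y <= M}, 0 \in Y,
      forall m, m \in M -> exists2 y, y \in Y & m - y \in N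
    & {in Y &, forall y y', y - y' \in N -> y = y'}].

Lemma addfsP A B z :
  reflect (exists a b, [/\ a \in A, b \in B & z = a + b]) (z \in addfs A B).
Proof.
apply: (iffP (imfset2P _ _ _ _ _)) => [[a aA [b bB ->]]|[a [b [aA bB ->]]]].
  by exists a, b.
by exists a => //; exists b.
Qed.

Lemma mem_addfs A B a b : a \in A -> b \in B -> a + b \in addfs A B.
Proof. by move=> aA bB; apply/addfsP; exists a, b. Qed.

Lemma mem_trfs x A z : (z \in trfs x A) = (z - x \in A).
Proof.
apply/imfsetP/idP => [[a /= aA ->]|zA]; first by rewrite addrC addKr.
by exists (z - x) => //=; rewrite addrC subrK.
Qed.

Lemma card_trfs x A : #|` trfs x A| = #|` A|.
Proof. by rewrite card_imfset //; apply: addrI. Qed.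

Lemma addfsC A B : addfs A B = addfs B A.
Proof.
by apply/fsetP => z; apply/addfsP/addfsP => -[a [b [aA bB ->]]];
  exists b, a; split => //; rewrite addrC.
Qed.

Lemma addfsA A B C : addfs A (addfs B C) = addfs (addfs A B) C.
Proof.
apply/fsetP => z; apply/addfsP/addfsP.
  move=> [a [u [aA /addfsP[b [c [bB cC ->]]] ->]]].
  by exists (a + b), c; rewrite addrA; split=> //; apply: mem_addfs.
move=> [u [c [/addfsP[a [b [aA bB ->]]] cC ->]]].
by exists a, (b + c); rewrite addrA; split=> //; apply: mem_addfs.
Qed.

Lemma addfs0 A : addfs A [fset 0]%fset = A.
Proof.
apply/fsetP => z; apply/addfsP/idP => [[a [b [aA]]]|zA].
  by rewrite inE => /eqP -> ->; rewrite addr0.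
by exists z, 0; rewrite addr0 inE.
Qed.

Lemma addfs1 A x : addfs A [fset x]%fset = trfs x A.
Proof.
apply/fsetP => z; rewrite mem_trfs; apply/addfsP/idP => [[a [b [aA]]]|zA].
  by rewrite inE => /eqP -> ->; rewrite addrK.
by exists (z - x), x; rewrite subrK inE.
Qed.

Lemma addfsU A B C : addfs A (B `|` C)%fset = (addfs A B `|` addfs A C)%fset.
Proof.
apply/fsetP => z; rewrite inE; apply/addfsP/orP.
  move=> [a [b [aA]]]; rewrite inE => /orP[] bB ->; [left|right];
  exact: mem_addfs.
by move=> [] /addfsP[a [b [aA bB ->]]]; exists a, b; rewrite inE bB ?orbT.
Qed.

Lemma trfs_addfsr x A B : trfs x (addfs A B) = addfs A (trfs x B).
Proof. by rewrite -!addfs1 addfsA. Qed.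

Lemma trfs_addfsl x A B : trfs x (addfs A B) = addfs (trfs x A) B.
Proof. by rewrite addfsC trfs_addfsr addfsC. Qed.

Lemma trfsU x A B : trfs x (A `|` B)%fset = (trfs x A `|` trfs x B)%fset.
Proof. by apply/fsetP => z; rewrite !inE !mem_trfs inE. Qed.

Lemma trfsD x A B : trfs x (A `\` B)%fset = (trfs x A `\` trfs x B)%fset.
Proof. by apply/fsetP => z; rewrite !inE !mem_trfs inE. Qed.

Lemma trfs_trfs x y A : trfs x (trfs y A) = trfs (x + y) A.
Proof. by apply/fsetP => z; rewrite !mem_trfs opprD addrA. Qed.

Lemma trfs_set1 x y : trfs x [fset y]%fset = [fset (x + y)%R]%fset.
Proof. by apply/fsetP => z; rewrite mem_trfs !inE subr_eq addrC. Qed.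

Lemma addfsS A A' B B' : (A `<=` A' -> B `<=` B' -> addfs A B `<=` addfs A' B')%fset.
Proof.
move=> /fsubsetP AA /fsubsetP BB; apply/fsubsetP => z /addfsP[a [b [aA bB ->]]].
by apply: mem_addfs; [apply: AA|apply: BB].
Qed.

Lemma card_addfs_le A B : (#|` addfs A B| <= #|` A| * #|` B|)%N.
Proof.
rewrite -(size_allpairs +%R); apply: uniq_leq_size; first exact: fset_uniq.
by move=> z /addfsP[a [b [aA bB ->]]]; apply: allpairs_f.
Qed.

Lemma card_addfs_ge A B b : b \in B -> (#|` A| <= #|` addfs A B|)%N.
Proof.
move=> bB; rewrite -(card_trfs b A) -addfs1; apply: fsubset_leq_card.
by apply: addfsS; rewrite ?fsub1set ?fsubset_refl.
Qed.

Lemma ssums0 s : 0 \in ssums s.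
Proof. by elim: s => [|x s IH] /=; rewrite !inE ?IH. Qed.

Lemma ssums_cat s1 s2 : ssums (s1 ++ s2) = addfs (ssums s1) (ssums s2).
Proof.
elim: s1 => [|x s IH] /=; first by rewrite addfsC addfs0.
by rewrite IH trfs_addfsl ![addfs _ (ssums s2)]addfsC addfsU.
Qed.

Lemma ssums1 x : ssums [:: x] = [fset 0; x]%fset.
Proof. by rewrite /= trfs_set1 addr0. Qed.

Lemma ssums_rcons s x : ssums (rcons s x) = (ssums s `|` trfs x (ssums s))%fset.
Proof. by rewrite -cats1 ssums_cat ssums1 addfsU addfs0 addfs1. Qed.

Lemma mem_ssums s x : x \in s -> x \in ssums s.
Proof.
elim: s => //= y s IH; rewrite !inE mem_trfs => /orP[/eqP ->|/IH -> //].
by rewrite subrr ssums0 orbT.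
Qed.

Lemma perm_ssums s1 s2 : perm_eq s1 s2 -> ssums s1 = ssums s2.
Proof.
move=> /permP; elim: s1 s2 => [|x s IH] s2 /= H.
  by case: s2 H => // y s2 /(_ predT).
have xs2 : x \in s2 by rewrite -has_pred1 has_count -H /= eqxx.
case/splitPr: xs2 H => u v H.
rewrite ssums_cat /= addfsU -trfs_addfsr -ssums_cat -IH // => a.
by have := H a; rewrite !count_cat /=; lia.
Qed.

Lemma fin_subgroup0 N : fin_subgroup N -> 0 \in N. Proof. by case. Qed.

Lemma fin_subgroupB N x y : fin_subgroup N -> x \in N -> y \in N -> x - y \in N.
Proof. by case=> _; apply. Qed.

Lemma fin_subgroupN N x : fin_subgroup N -> (- x \in N) = (x \in N).
Proof.
move=> gN; apply/idP/idP => xN; last by rewrite -sub0r fin_subgroupB // fin_subgroup0.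
by rewrite -[x]opprK -sub0r fin_subgroupB // fin_subgroup0.
Qed.

Lemma fin_subgroupD N x y : fin_subgroup N -> x \in N -> y \in N -> x + y \in N.
Proof. by move=> gN xN yN; rewrite -[y]opprK fin_subgroupB // fin_subgroupN. Qed.

Lemma fin_subgroupDl N x y : fin_subgroup N -> x \in N -> (x + y \in N) = (y \in N).
Proof.
move=> gN xN; apply/idP/idP => yN; last exact: fin_subgroupD.
by rewrite -(addrK x y) [y + x]addrC fin_subgroupB.
Qed.

Lemma fin_subgroupDr N x y : fin_subgroup N -> y \in N -> (x + y \in N) = (x \in N).
Proof. by move=> gN yN; rewrite addrC fin_subgroupDl. Qed.

Lemma fin_subgroupMn N x n : fin_subgroup N -> x \in N -> x *+ n \in N.
Proof.
move=> gN xN; elim: n => [|n IH]; first by rewrite mulr0n fin_subgroup0.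
by rewrite mulrS fin_subgroupD.
Qed.

Lemma fin_subgroup_gt0 N : fin_subgroup N -> (0 < #|` N|)%N.
Proof. by move=> /fin_subgroup0 N0; rewrite cardfs_gt0; apply/fset0Pn; exists 0. Qed.

Lemma addfs_sub_group M A B : fin_subgroup M -> {subset A <= M} -> {subset B <= M} ->
  {subset addfs A B <= M}.
Proof.
by move=> gM sA sB z /addfsP[a [b [aA bB ->]]]; apply: fin_subgroupD => //; [apply: sA|apply: sB].
Qed.

Lemma trfs_sub_group M x A : fin_subgroup M -> x \in M -> {subset A <= M} ->
  {subset trfs x A <= M}.
Proof.
move=> gM xM sA z; rewrite mem_trfs => /sA; rewrite fin_subgroupDr //.
by rewrite fin_subgroupN.
Qed.

Lemma ssums_sub M s : fin_subgroup M -> {subset s <= M} -> {subset ssums s <= M}.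
Proof.
move=> gM; elim: s => [|x s IH] /= sM z.
  by rewrite inE => /eqP ->; apply: fin_subgroup0.
have sM' : {subset s <= M} by move=> w ws; apply: sM; rewrite inE ws orbT.
rewrite inE => /orP[/IH-> //|]; apply: trfs_sub_group => //; last exact: IH.
by apply: sM; rewrite inE eqxx.
Qed.

Lemma mem_fib N Z y u : (u \in fib N Z y) = (u \in N) && (y + u \in Z).
Proof. by rewrite !inE. Qed.

(** Double counting: each [z] of [Z] lies in exactly one coset [y + N]. *)
Lemma card_fib N M Y Z : fin_subgroup N -> coset_reps N M Y -> {subset Z <= M} ->
  #|` Z| = (\sum_(y <- Y) #|` fib N Z y|)%N.
Proof.
move=> gN [_ _ cov inj] ZM.
have E1 z : z \in Z -> (\sum_(y <- Y) ((z - y)%R \in N) = 1)%N.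
  move=> zZ; have [y0 y0Y zy0] := cov _ (ZM _ zZ).
  rewrite (bigD1_seq y0) ?fset_uniq //= zy0 big_seq_cond big1 ?addn0 // => y.
  move=> /andP[yY /negP yy0]; case: (boolP (z - y \in N)) => // zy.
  case: yy0; apply/eqP; apply: inj => //.
  by have := fin_subgroupB gN zy0 zy; rewrite opprB addrC addrA subrK.
have E2 y : #|` fib N Z y| = (\sum_(z <- Z) ((z - y)%R \in N))%N.
  rewrite -(card_trfs y) (_ : trfs y _ = [fset z in Z | (z - y)%R \in N]%fset).
    by rewrite card_fset_sum1 big_fset /= big_mkcond.
  apply/fsetP => z; rewrite mem_trfs mem_fib !inE /=. by rewrite [y + _]addrC subrK andbC.
rewrite (eq_bigr _ (fun y _ => E2 y)) exchange_big /= card_fset_sum1.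
by rewrite big_seq [RHS]big_seq; apply: eq_bigr => z /E1 ->.
Qed.

Lemma coset_reps_card N M Y : fin_subgroup N -> coset_reps N M Y ->
  {subset N <= M} -> fin_subgroup M -> #|` M| = (#|` Y| * #|` N|)%N.
Proof.
move=> gN tY NM gM; rewrite (card_fib gN tY) // card_fset_sum1 big_distrl /=.
rewrite big_seq [RHS]big_seq; apply: eq_bigr => y yY; rewrite mul1n.
congr #|` _|; apply/fsetP => u; rewrite mem_fib.
case: (boolP (u \in N)) => //= uN; rewrite fin_subgroupD ?(NM _ uN) //.
by case: tY => YM _ _ _; apply: YM.
Qed.

Lemma fib_addfs N X W y : fin_subgroup N -> {subset X <= N} ->
  fib N (addfs X W) y = addfs X (fib N W y).
Proof.
move=> gN XN; apply/fsetP => u; rewrite mem_fib; apply/andP/addfsP.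
  move=> [uN /addfsP[x [w [xX wW E]]]]; exists x, (u - x).
  rewrite mem_fib addrA E [x + w]addrC addrK wW andbT [x + _]addrC subrK.
  by split=> //; apply: fin_subgroupB => //; apply: XN.
move=> [x [v [xX + ->]]]; rewrite mem_fib => /andP[vN yv].
split; first by apply: fin_subgroupD => //; apply: XN.
by rewrite addrCA; apply: mem_addfs.
Qed.

Lemma fib_trfs N W t y : fin_subgroup N -> t \in N ->
  fib N (trfs t W) y = trfs t (fib N W y).
Proof.
move=> gN tN; have tN' : {subset [fset t]%fset <= N} by move=> u; rewrite inE => /eqP ->.
by rewrite -addfs1 addfsC fib_addfs // addfsC addfs1.
Qed.

Lemma fibU N Z Z' y : fib N (Z `|` Z')%fset y = (fib N Z y `|` fib N Z' y)%fset.
Proof. by apply/fsetP => u; rewrite !(inE, mem_fib) andb_orr. Qed.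

Lemma fibD N Z Z' y : fib N (Z `\` Z')%fset y = (fib N Z y `\` fib N Z' y)%fset.
Proof.
apply/fsetP => u; rewrite !(inE, mem_fib); by case: (u \in N).
Qed.

Lemma coset_reps_comp N N1 M Y1 Y2 : fin_subgroup N -> fin_subgroup N1 ->
  fin_subgroup M -> {subset N <= N1} -> {subset N1 <= M} ->
  coset_reps N N1 Y1 -> coset_reps N1 M Y2 -> coset_reps N M (addfs Y1 Y2).
Proof.
move=> gN gN1 gM NN1 N1M [Y1N Y10 c1 i1] [Y2M Y20 c2 i2]; split.
- by apply: addfs_sub_group => // y yY; apply: N1M; apply: Y1N.
- by rewrite -[0]addr0; apply: mem_addfs.
- move=> m /c2[y2 y2Y /c1[y1 y1Y H]]; exists (y1 + y2); first exact: mem_addfs.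
  by rewrite [y1 + y2]addrC opprD addrA.
move=> _ _ /addfsP[a [b [aY bY ->]]] /addfsP[a' [b' [aY' bY' ->]]] H.
have E : b = b'.
  apply: i2 => //; move: (H) => /NN1; rewrite opprD addrACA (@fin_subgroupDl _ (a - a')) //.
  by apply: fin_subgroupB => //; apply: Y1N.
by move: H; rewrite E opprD addrACA subrr addr0 => /i1 ->.
Qed.

(** As [K] contains [N], the representative of an element of [K] lies in [K]. This makes a
    transversal usable at intermediate members of the filtration. *)
Lemma coset_reps_cap N M K Y : fin_subgroup N -> fin_subgroup K ->
  {subset N <= K} -> {subset K <= M} ->
  coset_reps N M Y -> coset_reps N K [fset y in Y | y \in K]%fset.
Proof.
move=> gN gK NK KM [YM Y0 c i]; split.
- by move=> y; rewrite !inE => /andP[].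
- by rewrite !inE Y0 fin_subgroup0.
- move=> k kK; have [y yY ky] := c _ (KM _ kK); exists y => //.
  rewrite !inE yY /= -(fin_subgroupN _ gK) -(@fin_subgroupDl _ k) //.
  exact: NK.
by move=> y y'; rewrite !inE => /andP[yY _] /andP[yY' _]; apply: i.
Qed.

Lemma card_addfs_sub_coset_reps N M Y X W : fin_subgroup N -> coset_reps N M Y ->
  {subset X <= N} -> {subset W <= Y} -> #|` addfs X W| = (#|` X| * #|` W|)%N.
Proof.
move=> gN [_ _ _ i] XN WY.
rewrite -(size_allpairs +%R); apply/perm_size/uniq_perm; first exact: fset_uniq.
  apply: allpairs_uniq; try exact: fset_uniq.
  move=> [? ?] [? ?] /allpairsP[[x y] /= [xX /WY yY [-> ->]]].
  move=> /allpairsP[[x' y'] /= [xX' /WY yY' [-> ->]]] /= E.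
  have E' : y - y' = x' - x by apply/eqP; rewrite subr_eq addrAC eq_sym subr_eq -E addrC.
  have := E; rewrite (i _ _ yY yY'); first by move=> /addIr ->.
  by rewrite E'; apply: fin_subgroupB => //; apply: XN.
move=> z; apply/addfsP/allpairsP => [[a [b [aA bB ->]]]|[[a b] [/= aA bB ->]]].
  by exists (a, b).
by exists a, b.
Qed.

Lemma coset_reps_id N : fin_subgroup N -> coset_reps N N [fset 0]%fset.
Proof.
move=> gN; split.
- by move=> y; rewrite inE => /eqP ->; apply: fin_subgroup0.
- by rewrite inE.
- by move=> m mN; exists 0; rewrite ?inE // subr0.
by move=> y y'; rewrite !inE => /eqP -> /eqP ->.
Qed.
End Sumsets.

(** * Runs of multiples of an element and cyclic extensions of a finite subgroup *)

Section Runs.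
Variable G : zmodType.
Implicit Types (A B C N M X Y Z : {fset G}) (x y z t g : G) (s o : seq G).

Definition ord_mod N g q :=
  [/\ (0 < q)%N, g *+ q \in N & forall k, (0 < k < q)%N -> g *+ k \notin N].

Definition run g a L : {fset G} := [fset (g *+ i - g *+ a)%R | i in iota 0 L]%fset.

Definition adjoin N g q : {fset G} := addfs N (run g 0 q).

Lemma runP g a L x : reflect (exists2 i, (i < L)%N & x = g *+ i - g *+ a) (x \in run g a L).
Proof.
apply: (iffP (imfsetP _ _ _ _)) => [[i /= iL ->]|[i iL ->]]; exists i => //.
  by move: iL; rewrite mem_iota add0n.
by rewrite /= mem_iota add0n.
Qed.

Lemma mem_run g a L i : (i < L)%N -> g *+ i - g *+ a \in run g a L.
Proof. by move=> iL; apply/runP; exists i. Qed.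

Lemma run_extr g a L w : (w <= L)%N ->
  (run g a L `|` trfs (g *+ w) (run g a L))%fset = run g a (L + w).
Proof.
move=> wL; apply/fsetP => x; rewrite inE mem_trfs; apply/orP/runP.
  move=> [/runP[i iL ->]|/runP[i iL]]; first by exists i => //; lia.
  move=> /eqP; rewrite subr_eq addrAC -mulrnDr => /eqP ->.
  by exists (i + w)%N => //; lia.
move=> [i iL ->]; case: (ltnP i L) => H; [left|right].
  exact: mem_run.
apply/runP; exists (i - w)%N; first by lia.
by rewrite mulrnBr 1?addrAC //; lia.
Qed.

Lemma run_extl g a L w : (w <= L)%N ->
  (run g a L `|` trfs (- (g *+ w)) (run g a L))%fset = run g (a + w) (L + w).
Proof.
move=> wL; apply/fsetP => x; rewrite inE mem_trfs opprK; apply/orP/runP.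
  move=> [/runP[i iL ->]|/runP[i iL]].
    exists (i + w)%N; first lia.
    by rewrite !mulrnDr opprD addrACA subrr addr0.
  move=> /eqP; rewrite eq_sym -subr_eq -addrA -opprD -mulrnDr => /eqP <-.
  by exists i => //; lia.
move=> [i iL ->]; case: (ltnP i w) => H; [right|left]; apply/runP.
  by exists i; [lia|rewrite mulrnDr opprD addrA subrK].
exists (i - w)%N; first by lia.
by rewrite mulrnBr // mulrnDr opprD addrA addrAC.
Qed.

Lemma ord_mod_inj N g q i j : fin_subgroup N -> ord_mod N g q -> (i < q)%N -> (j < q)%N ->
  g *+ i - g *+ j \in N -> i = j.
Proof.
move=> gN [q0 _ qk] iq jq H.
case: (ltngtP i j) => // ij.
  have := qk (j - i)%N; rewrite mulrnBr ?(ltnW ij) // -opprB fin_subgroupN // H.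
  by move=> E; have : false by apply: E; lia.
have := qk (i - j)%N; rewrite mulrnBr ?(ltnW ij) // H.
by move=> E; have : false by apply: E; lia.
Qed.

Lemma card_run N g q a L : fin_subgroup N -> ord_mod N g q -> (L <= q)%N ->
  #|` run g a L| = L.
Proof.
move=> gN og Lq; rewrite card_in_imfset.
  by rewrite [enum_finmem _]undup_id ?iota_uniq // size_iota.
move=> i j; rewrite !mem_iota add0n => /= iL jL /addIr E.
by apply: (ord_mod_inj gN og); rewrite ?E ?subrr ?fin_subgroup0 //; lia.
Qed.

Lemma adjoinP N g q x : fin_subgroup N -> ord_mod N g q ->
  reflect (exists2 u, u \in N & exists i, x = u + g *+ i) (x \in adjoin N g q).
Proof.
move=> gN [q0 qN qk]; apply: (iffP (addfsP _ _ _)).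
  by move=> [u [_ [uN /runP[i iq ->] ->]]]; exists u => //; exists i; rewrite mulr0n subr0.
move=> [u uN [i ->]]; exists (u + g *+ q *+ (i %/ q)), (g *+ (i %% q)); split.
- by apply: fin_subgroupD => //; apply: fin_subgroupMn.
- by apply/runP; exists (i %% q)%N; rewrite ?ltn_mod ?mulr0n ?subr0.
by rewrite -mulrnA -addrA -mulrnDr mulnC -divn_eq.
Qed.

Lemma adjoin_subgroup N g q : fin_subgroup N -> ord_mod N g q ->
  fin_subgroup (adjoin N g q).
Proof.
move=> gN og; split.
  by apply/adjoinP => //; exists 0; rewrite ?fin_subgroup0 //; exists 0%N; rewrite addr0.
move=> _ _ /(adjoinP _ gN og)[u uN [i ->]] /(adjoinP _ gN og)[v vN [j ->]].
have [q0 qN _] := og.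
apply/adjoinP => //; exists (u - v - g *+ q *+ j).
  by rewrite !fin_subgroupB // fin_subgroupMn.
have E : g *+ (j * q.-1) = g *+ q *+ j - g *+ j.
  rewrite -mulrnA -mulrnBr ?leq_pmull //; congr (_ *+ _).
  by case: q q0 {og qN} => // q _; rewrite mulSn addKn mulnC.
by exists (i + j * q.-1)%N; rewrite mulrnDr E opprD addrACA 
  [g *+ i + (_ - _)]addrCA [RHS]addrA subrK.
Qed.

Lemma sub_adjoin N g q : fin_subgroup N -> ord_mod N g q -> {subset N <= adjoin N g q}.
Proof.
by move=> gN og x xN; apply/adjoinP => //; exists x => //; exists 0%N; rewrite addr0.
Qed.

Lemma mem_adjoin N g q : fin_subgroup N -> ord_mod N g q -> g \in adjoin N g q.
Proof.
move=> gN og; apply/adjoinP => //; exists 0; first exact: fin_subgroup0.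
by exists 1%N; rewrite add0r.
Qed.

Lemma adjoin_sub N M g q : fin_subgroup N -> ord_mod N g q -> fin_subgroup M ->
  {subset N <= M} -> g \in M -> {subset adjoin N g q <= M}.
Proof.
move=> gN og gM NM gM' x /(adjoinP _ gN og)[u uN [i ->]].
by apply: fin_subgroupD => //; [apply: NM|apply: fin_subgroupMn].
Qed.

Lemma run_coset_reps N g q a : fin_subgroup N -> ord_mod N g q -> (a < q)%N ->
  coset_reps N (adjoin N g q) (run g a q).
Proof.
move=> gN og aq; have gA := adjoin_subgroup gN og; have gM := mem_adjoin gN og.
have [q0 qN _] := og; split.
- by move=> _ /runP[i iq ->]; apply: fin_subgroupB => //; apply: fin_subgroupMn.
- by apply/runP; exists a => //; rewrite subrr.
- move=> _ /(adjoinP _ gN og)[u uN [i ->]].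
  exists (g *+ ((i + a) %% q) - g *+ a); first by apply: mem_run; rewrite ltn_mod.
  rewrite opprB addrA -[u + _ + _]addrA -mulrnDr {1}(divn_eq (i + a) q).
  rewrite mulrnDr addrA addrK.
  by apply: fin_subgroupD => //; rewrite mulnC mulrnA fin_subgroupMn.
move=> _ _ /runP[i iq ->] /runP[j jq ->]; rewrite opprB addrA subrK => H.
by rewrite (ord_mod_inj gN og iq jq H).
Qed.

(* Binary expansion: [g, 2g, ..., 2^(k-1) g] produce [0 <= i < 2^k], and the extra element
   [- a g] with [a = L - 2^k] extends this interval to the left. *)
Lemma run_ssums N g q L : fin_subgroup N -> ord_mod N g q -> (0 < L <= q)%N ->
  exists o a, [/\ uniq o, 0 \notin o, ssums o = run g a L & (a.*2 < L)%N].
Proof.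
move=> gN og /andP[L0 Lq]; pose k := trunc_log 2 L; pose a := (L - 2 ^ k)%N.
have /andP[kL Lk] : (2 ^ k <= L < 2 ^ k.+1)%N by rewrite trunc_logP //= trunc_log_ltn.
pose pw k := mkseq (fun i => g *+ (2 ^ i)) k.
have n0 i : (0 < i < q)%N -> g *+ i != 0.
  have [_ _ qk] := og; move=> /qk; apply: contraNneq => ->; exact: fin_subgroup0.
have inj i j : (i < q)%N -> (j < q)%N -> g *+ i = g *+ j -> i = j.
  move=> iq jq E; apply: (ord_mod_inj gN og) => //.
  by rewrite E subrr fin_subgroup0.
have lt2 i : (i < k)%N -> (2 ^ i < q)%N.
  move=> ik; apply: leq_trans Lq; apply: leq_trans kL.
  by rewrite ltn_exp2l.
have pwP j : ssums (pw j) = run g 0 (2 ^ j).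
  elim: j => [|j IH].
    rewrite /= expn0; apply/fsetP => x; rewrite inE; apply/eqP/runP => [->|[[|i] // _ ->]].
      by exists 0%N; rewrite // subrr.
    by rewrite subrr.
  by rewrite /pw mkseqS ssums_rcons -/(pw j) IH run_extr // expnS mul2n addnn.
have upw : uniq (pw k).
  rewrite map_inj_in_uniq ?iota_uniq // => i j; rewrite !mem_iota add0n /= => ik jk E.
  by apply/eqP; rewrite -(@eqn_exp2l 2) //; apply/eqP/inj; rewrite ?lt2.
have npw : 0 \notin pw k.
  apply/negP => /mapP[i]; rewrite mem_iota add0n /= => ik E.
  by have := n0 (2 ^ i)%N; rewrite -E eqxx expn_gt0 /= lt2 // => /(_ isT).
have aE : (a + 2 ^ k = L)%N by rewrite subnK.
have a2 : (a.*2 < L)%N by move: Lk; rewrite expnS; lia.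
have [a0|a0] := posnP a.
  by exists (pw k), 0%N; split=> //; rewrite pwP -aE a0.
exists (rcons (pw k) (- (g *+ a))), a; split=> //.
- rewrite rcons_uniq upw andbT; apply/negP => /mapP[i]; rewrite mem_iota add0n /= => ik E.
  (* If [- a g] were equal to [2^i g], then [(a + 2^i) g] would vanish although
     [0 < a + 2^i < q]. *)
  have : g *+ (a + 2 ^ i) != 0.
    apply: n0; rewrite addn_gt0 a0 /=; apply: leq_trans Lq; rewrite -aE ltn_add2l.
    by rewrite ltn_exp2l.
  by rewrite mulrnDr -E subrr eqxx.
- rewrite mem_rcons inE negb_or npw andbT eq_sym oppr_eq0 n0 // a0 /=.
  by apply: leq_trans Lq; lia.
rewrite ssums_rcons pwP run_extl //; last by move: Lk; rewrite expnS; lia.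
by rewrite add0n addnC aE.
Qed.

End Runs.

(** * Tiles *)

Section Tiles.
Variable G : zmodType.
Implicit Types (A B C N M X Y Z W : {fset G}) (x y z t g : G) (s o : seq G).

Lemma coset_reps_eq0 N M Y y : coset_reps N M Y -> y \in Y -> y \in N -> y = 0.
Proof. by move=> [_ Y0 _ i] yY yN; apply: i => //; rewrite subr0. Qed.

Lemma fin_subgroup_torsion M g : fin_subgroup M -> g \in M ->
  exists2 n, (0 < n)%N & (n <= #|` M|)%N /\ g *+ n = 0.
Proof.
move=> gM gM'; pose s := mkseq (fun i => g *+ i) #|` M|.+1.
have : ~~ uniq s.
  apply/negP => us; have := uniq_leq_size us (s2 := M).
  rewrite size_mkseq ltnn => E; have : false by apply: E => _ /mapP[i _ ->]; apply: fin_subgroupMn.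
  by [].
move=> /(uniqPn 0)[i [j [ij]]]; rewrite size_mkseq => jM.
rewrite !nth_mkseq //; last exact: ltn_trans jM.
move=> E; exists (j - i)%N; first by rewrite subn_gt0.
split; first by rewrite leq_subLR (leq_trans _ (leq_addl _ _)).
by rewrite mulrnBr ?(ltnW ij) // E subrr.
Qed.

Lemma ord_mod_ex N M g : fin_subgroup N -> fin_subgroup M -> g \in M ->
  exists q, ord_mod N g q.
Proof.
move=> gN gM gM'; have [n n0 [_ ng]] := fin_subgroup_torsion gM gM'.
have ex : exists n, (0 < n)%N && (g *+ n \in N).
  by exists n; rewrite n0 ng fin_subgroup0.
case: (ex_minnP ex) => q /andP[q0 qN] qmin; exists q; split=> // k /andP[k0 kq].
apply/negP => kN; have := qmin k; rewrite k0 kN => /(_ isT); lia.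
Qed.

(** Induction on the size of [M] outside [N]: a full run of multiples of some [g] outside [N] is a
    transversal of [N] in [adjoin N g q], and it is combined with a transversal of that subgroup in
    [M]. *)
Lemma coset_reps_fill N M : fin_subgroup N -> fin_subgroup M -> {subset N <= M} ->
  exists D, [/\ uniq D, 0 \notin D & coset_reps N M (ssums D)].
Proof.
move: {2}(#|` M| - #|` N|)%N (leqnn (#|` M| - #|` N|)%N) => n.
elim: n N => [|n IH] N Hn gN gM NM.
  have E : N = M.
    by apply/eqP; rewrite eqEfcard; apply/andP; split; [apply/fsubsetP|lia].
  by exists [::]; split=> //; rewrite -E; apply: coset_reps_id.
have [/fsubsetP MN|/fsubsetPn[g gM' gN']] := boolP (M `<=` N)%fset.
  have E : N = M by apply/fsetP => x; apply/idP/idP => [/NM|/MN].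
  by exists [::]; split=> //; rewrite -E; apply: coset_reps_id.
have [q og] := ord_mod_ex gN gM gM'.
have [q0 _ _] := og.
have gA := adjoin_subgroup gN og; have NA := sub_adjoin gN og.
have AM := adjoin_sub gN og gM NM gM'.
have [|D [uD D0 rD]] := IH (adjoin N g q) _ gA gM AM.
  have : (N `<` adjoin N g q)%fset.
    rewrite fproperEneq; apply/andP; split; last by apply/fsubsetP.
    by apply: contraNneq gN' => ->; apply: mem_adjoin.
  move=> /fproper_ltn_card; have : (#|` adjoin N g q| <= #|` M|)%N.
    by apply/fsubset_leq_card/fsubsetP.
  by lia.
have [|o [a [uo o0 so aq]]] := run_ssums (L := q) gN og; first by rewrite q0 /=.
have ro : coset_reps N (adjoin N g q) (ssums o) by rewrite so; apply: run_coset_reps => //; lia.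
exists (o ++ D); split.
- rewrite cat_uniq uo uD andbT /=; apply/hasPn => d dD; apply/negP => do_.
  have dA : d \in adjoin N g q by case: ro => sub _ _ _; apply: sub; apply: mem_ssums.
  by move: D0; rewrite -(coset_reps_eq0 rD (mem_ssums dD) dA) dD.
- by rewrite mem_cat negb_or o0.
by rewrite ssums_cat; apply: coset_reps_comp ro rD.
Qed.

(** This is [ssums (rcons o z)], with the two halves kept apart because their overlap matters. *)
Definition span2 o z : {fset G} := (ssums o `|` trfs z (ssums o))%fset.

(* Adjoining [o] and [z + t], where [t] lies in [N], to a list whose set of subset sums is
   [X], a subset of [N], produces in each coset of [N] in [M] a translate of [X], of [t + X]
   or of their union: see [layerE] and [fib_layer_cases]. *)
Definition tile N M o z :=
  [/\ uniq o, 0 \notin o, z != 0 & coset_reps N M (span2 o z)].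

Lemma ssums_span2 o z : {subset ssums o <= span2 o z}.
Proof. by move=> x; rewrite inE => ->. Qed.

Lemma mem_span2 o z : z \in span2 o z.
Proof. by rewrite inE mem_trfs subrr ssums0 orbT. Qed.

Lemma card_span2 o z : (#|` ssums o| <= #|` span2 o z| <= 2 * #|` ssums o|)%N.
Proof.
by rewrite fsubset_leq_card ?fsubsetUl //= cardfsU card_trfs mul2n -addnn leq_subr.
Qed.

Section TileTheory.
Variables (N M : {fset G}) (o : seq G) (z : G).
Hypotheses (gN : fin_subgroup N) (gM : fin_subgroup M) (NM : {subset N <= M}).
Hypothesis tl : tile N M o z.

Lemma tile_sub : {subset ssums o <= M}.
Proof. by have [_ _ _ [sub _ _ _]] := tl; move=> x /ssums_span2 /sub. Qed.

Lemma tile_subo : {subset o <= M}.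
Proof. by move=> x /mem_ssums /tile_sub. Qed.

Lemma tile_mem : z \in M.
Proof. by have [_ _ _ [sub _ _ _]] := tl; apply: sub; apply: mem_span2. Qed.

Lemma tile_notin : z \notin N.
Proof.
have [_ _ z0 r] := tl; apply: contra z0 => zN; apply/eqP.
exact: coset_reps_eq0 r (mem_span2 _ _) zN.
Qed.

Lemma tile_disj x : x \in o -> x \notin N.
Proof.
have [_ o0 _ r] := tl; move=> xo; apply: contraNN o0 => xN.
by rewrite -(coset_reps_eq0 r _ xN) // ssums_span2 // mem_ssums.
Qed.

(** If [z + t] were in [o], the transversal would contain both [z] and [z + t], which are congruent
    modulo [N]. *)
Lemma tile_rcons_uniq t : t \in N -> t != 0 -> uniq (rcons o (z + t)).
Proof.
have [uo _ _ [_ _ _ i]] := tl.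
move=> tN t0; rewrite rcons_uniq uo andbT; apply: contraNN t0 => zo.
have E : z + t = z.
  by apply: i; rewrite ?mem_span2 ?ssums_span2 ?mem_ssums // addrC addKr.
by rewrite -(addKr z t) E addrC subrr.
Qed.

Lemma tile_rcons_disj t x : t \in N -> x \in rcons o (z + t) -> x \notin N.
Proof.
move=> tN; rewrite mem_rcons inE => /orP[/eqP ->|/tile_disj //].
by rewrite fin_subgroupDr // tile_notin.
Qed.

Lemma tile_rcons_sub t : t \in N -> {subset rcons o (z + t) <= M}.
Proof.
move=> tN x; rewrite mem_rcons inE => /orP[/eqP ->|/tile_subo //].
by apply: fin_subgroupD => //; [apply: tile_mem|apply: NM].
Qed.

Lemma fib_reps X W y : {subset X <= N} -> {subset W <= span2 o z} -> y \in span2 o z ->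
  fib N (addfs X W) y = if y \in W then X else fset0.
Proof.
have [_ _ _ r] := tl; have [_ _ _ i] := r.
move=> XN WY yY; rewrite fib_addfs //.
have -> : fib N W y = if y \in W then [fset 0]%fset else fset0.
  apply/fsetP => u; rewrite mem_fib; apply/andP/idP.
    move=> [uN yuW]; have E : y + u = y.
      by apply: i => //; [apply: WY|rewrite addrC addKr].
    by rewrite -{1}E yuW inE -(addKr y u) E addrC subrr.
  case: ifP => //; rewrite !inE => yW /eqP ->.
  by rewrite addr0 yW fin_subgroup0.
case: ifP => _; first exact: addfs0.
by apply/fsetP => x; rewrite !inE; apply/addfsP => -[a [b [_ ]]]; rewrite inE.
Qed.

Definition layer X t : {fset G} :=
  (addfs X (ssums o) `|` addfs (trfs t X) (trfs z (ssums o)))%fset.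

Lemma layerE X t : addfs X (ssums (rcons o (z + t))) = layer X t.
Proof.
rewrite ssums_rcons addfsU; congr (_ `|` _)%fset.
by rewrite [z + t]addrC -trfs_trfs -trfs_addfsr trfs_addfsl.
Qed.

Lemma fib_layer X t y : {subset X <= N} -> t \in N -> y \in span2 o z ->
  fib N (layer X t) y = ((if y \in ssums o then X else fset0) `|`
                         (if y \in trfs z (ssums o) then trfs t X else fset0))%fset.
Proof.
move=> XN tN yY; rewrite fibU !fib_reps //.
- by move=> x; apply: trfs_sub_group.
- by move=> x xW; rewrite inE xW orbT.
exact: ssums_span2.
Qed.

Lemma layer_sub X t : {subset X <= N} -> t \in N -> {subset layer X t <= M}.
Proof.
move=> XN tN x; rewrite inE => /orP[]; apply: addfs_sub_group => //.
- by move=> u /XN /NM.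
- exact: tile_sub.
- by move=> u uX; apply: NM; move: u uX; apply: trfs_sub_group.
by apply: trfs_sub_group => //; [apply: tile_mem|apply: tile_sub].
Qed.

Lemma fib_layer_cases X t y : {subset X <= N} -> t \in N -> y \in span2 o z ->
  [\/ fib N (layer X t) y = X, fib N (layer X t) y = trfs t X |
      fib N (layer X t) y = (X `|` trfs t X)%fset].
Proof.
move=> XN tN yY; rewrite fib_layer //; move: yY; rewrite inE.
case: ifP => _; case: ifP => // _ _; first by constructor 3.
  by constructor 1; rewrite fsetU0.
by constructor 2; rewrite fset0U.
Qed.

(** The cosets represented both in [ssums o] and in its translate by [z] carry the union, the others
    a single translate of [X]; inclusion-exclusion counts the former. *)
Lemma card_layer X t : {subset X <= N} -> t \in N ->
  #|` layer X t| = (#|` X| * (2 * (#|` span2 o z| - #|` ssums o|)) +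
    #|` (X `|` trfs t X)%fset| * (2 * #|` ssums o| - #|` span2 o z|))%N.
Proof.
have [_ _ _ r] := tl.
move=> XN tN; rewrite (card_fib gN r); last exact: layer_sub.
set P := ssums o; set Q := trfs z P.
have E y : y \in span2 o z -> #|` fib N (layer X t) y| =
   (#|` X| * ((y \notin P) + (y \notin Q)) +
    #|` (X `|` trfs t X)%fset| * ((y \in P) && (y \in Q)))%N.
  move=> yY; rewrite fib_layer //; move: yY; rewrite inE -/P -/Q.
  case: (y \in P); case: (y \in Q) => //= _.
  - by rewrite muln0 muln1.
  - by rewrite fsetU0 muln0 muln1 addn0.
  by rewrite fset0U card_trfs muln0 muln1 addn0.
rewrite big_seq (eq_bigr _ E) -big_seq big_split -!big_distrr /= big_split /=.
have cnt (p : pred G) : (\sum_(y <- span2 o z) p y)%N =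
    #|` [fset y in span2 o z | p y]%fset|.
  by rewrite card_fset_sum1 big_fset /= [RHS]big_mkcond.
rewrite !cnt.
have -> : [fset y in span2 o z | y \notin P]%fset = (span2 o z `\` P)%fset.
  by apply/fsetP => y; rewrite !inE andbC.
have -> : [fset y in span2 o z | y \notin Q]%fset = (span2 o z `\` Q)%fset.
  by apply/fsetP => y; rewrite !inE andbC.
have -> : [fset y in span2 o z | (y \in P) && (y \in Q)]%fset = (P `&` Q)%fset.
  by apply/fsetP => y; rewrite !inE; case: (y \in P); case: (y \in Q).
rewrite !cardfsDS ?fsubsetUl ?fsubsetUr //.
have -> : #|` (P `&` Q)%fset| = (2 * #|` P| - #|` span2 o z|)%N.
  by have := cardfsUI P Q; rewrite -/(span2 o z) /Q card_trfs; lia.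
by rewrite /Q card_trfs [(2 * (_ - _))%N]mul2n addnn.
Qed.

End TileTheory.

(** Appending to [o] a list that fills [M'] over [M] multiplies both cardinalities by the same
    factor. So a tile found in some finite subgroup can be carried to a member of the filtration
    without changing its proportions. *)
Lemma tile_ext N M M' o z : fin_subgroup N -> fin_subgroup M -> fin_subgroup M' ->
  {subset N <= M} -> {subset M <= M'} -> tile N M o z ->
  exists o', [/\ tile N M' o' z, (- z \in ssums o') = (- z \in ssums o),
    {in M, forall x, (x \in o') = (x \in o)} &
    exists2 c, (0 < c)%N & #|` ssums o'| = (#|` ssums o| * c)%N /\
                           #|` span2 o' z| = (#|` span2 o z| * c)%N].
Proof.
move=> gN gM gM' NM MM tl; have [D [uD D0 rD]] := coset_reps_fill gM gM' MM.
have [uo o0 z0 r] := tl.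
have dD d : d \in D -> d \notin M.
  move=> dD; apply: contraNN D0 => dM.
  by rewrite -(coset_reps_eq0 rD (mem_ssums dD) dM).
have sE : span2 (o ++ D) z = addfs (span2 o z) (ssums D).
  by rewrite /span2 ssums_cat trfs_addfsl ![addfs _ (ssums D)]addfsC addfsU.
exists (o ++ D); split.
- split=> //.
  + rewrite cat_uniq uo uD andbT /=; apply/hasPn => d /dD.
    by apply: contraNN => /(tile_subo tl).
  + by rewrite mem_cat negb_or o0.
  by rewrite sE; apply: coset_reps_comp r rD.
- rewrite ssums_cat; apply/addfsP/idP => [[a [b [aO bD E]]]|zo]; last first.
    by exists (- z), 0; rewrite ssums0 addr0.
  rewrite E -[a]addr0; have -> : b = 0.
    apply: (coset_reps_eq0 rD bD); rewrite -(@fin_subgroupDl _ M a) // -?E.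
      by rewrite fin_subgroupN // (tile_mem tl).
    exact: tile_sub tl _ aO.
  by rewrite !addr0.
- by move=> x xM; rewrite mem_cat; case: (boolP (x \in D)) => [/dD|]; rewrite ?xM ?orbF.
exists #|` ssums D|; first by rewrite cardfs_gt0; apply/fset0Pn; exists 0; apply: ssums0.
rewrite sE ssums_cat; split; apply: (card_addfs_sub_coset_reps gM rD) => //.
  exact: tile_sub tl.
by case: r.
Qed.

End Tiles.

(** * Tiles inside a cyclic extension *)

Section TileExistence.
Variable G : zmodType.
Implicit Types (A B C N M X Y Z W : {fset G}) (x y z t g : G) (s o : seq G).

(* An interval of [L] multiples of [g] and its translate by [r g], where [L + r = q] and [r]
   is about [q / 3]. For [q = 4] no such choice has an overlap, whence the special tile
   [{g, - g}], [z = 2 g], which needs [4 g = 0]. *)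
Lemma run_tile_up N g q : fin_subgroup N -> ord_mod N g q -> (2 < q)%N ->
  (q != 4)%N || (g *+ 4 == 0) ->
  exists o z, [/\ tile N (adjoin N g q) o z, - z \notin ssums o,
    (4 * #|` span2 o z| <= 7 * #|` ssums o|)%N &
    (4 * #|` ssums o| <= 3 * #|` span2 o z|)%N].
Proof.
move=> gN og q3 /orP Hq; have [q0 qN qk] := og.
have n0 i : (0 < i < q)%N -> g *+ i != 0.
  by move=> /qk; apply: contraNneq => ->; exact: fin_subgroup0.
have [q4|q4] := eqVneq q 4%N.
  subst q; have g4 : g *+ 4 = 0 by case: Hq => [//|/eqP].
  have sE : ssums [:: g; - g] = run g 1 3.
    rewrite /= trfs_set1 addr0 trfsU !trfs_set1 addr0 subrr.
    apply/fsetP => x; rewrite !inE; apply/idP/runP.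
      move=> /orP[/orP[|]|/orP[|]] /eqP ->.
      - by exists 1%N; rewrite // subrr.
      - by exists 0%N; rewrite // mulr0n sub0r.
      - by exists 2%N; rewrite // mulrS addrK.
      by exists 1%N; rewrite // subrr.
    move=> [[|[|[|]]]] // _ ->; first by rewrite mulr0n sub0r eqxx !orbT.
      by rewrite subrr eqxx.
    by rewrite mulrS addrK eqxx !orbT.
  have sp : span2 [:: g; - g] (g *+ 2) = run g 1 4.
    rewrite /span2 sE; apply/fsetP => x; rewrite inE mem_trfs; apply/orP/runP.
      move=> [/runP[i i3 ->]|/runP[i i3 /eqP]]; first by exists i => //; lia.
      rewrite subr_eq addrAC -mulrnDr => /eqP ->; case: i i3 => [|[|[|]]] // _.
      - by exists 2%N.
      - by exists 3%N.
      by exists 0%N => //; rewrite (_ : (2 + 2)%N = 4%N) // g4.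
    move=> [[|[|[|[|]]]] // _ ->]; [left|left|left|right]; apply/runP.
    - by exists 0%N.
    - by exists 1%N.
    - by exists 2%N.
    by exists 1%N => //; rewrite -addrA -opprD -mulrnDr !subrr.
  exists [:: g; - g], (g *+ 2); split.
  - split.
    + rewrite /= inE andbT; apply: contraTneq (n0 2 isT) => E.
      by rewrite mulrS {2}E subrr eqxx.
    + by rewrite !inE negb_or !(eq_sym 0) oppr_eq0 andbb (n0 1%N).
    + exact: n0.
    by rewrite sp; apply: run_coset_reps.
  - rewrite sE; apply/runP => -[i i3 E]; have : g *+ (i + 1) == 0.
      by rewrite mulrnDr -[g *+ i](subrK (g *+ 1)) -E -addrA -mulrnDr addNr.
    by apply/negP; apply: n0; lia.
  - by rewrite sp sE !(card_run 1 gN og).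
  by rewrite sp sE !(card_run 1 gN og).
(* [r] is [q / 3] rounded up. The two size bounds amount to [7 r <= 3 q] and [q <= 4 r]; for [q > 2]
   the first fails only at [q = 4]. *)
pose r := ((q + 2) %/ 3)%N; pose L := (q - r)%N.
have rE : (3 * r <= q + 2)%N by rewrite /r mulnC leq_divM.
have rE' : (q <= 3 * r)%N by rewrite /r; lia.
have [|o [a [uo o0 so aL]]] := run_ssums (L := L) gN og; first by rewrite /L; lia.
have sp : span2 o (g *+ r) = run g a q.
  by rewrite /span2 so run_extr /L ?subnK //; lia.
exists o, (g *+ r); split.
- split=> //; first by apply: n0; lia.
  by rewrite sp; apply: run_coset_reps => //; rewrite /L in aL; lia.
(* From [2 a < L <= 2 r] follows [a < r], so [i + r - a] lies strictly between 0 and [q]. *)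
- rewrite so; apply/runP => -[i iL E]; have : g *+ (i + r - a) == 0.
    rewrite mulrnBr; last by rewrite /L in aL; lia.
    by rewrite mulrnDr addrAC -E addNr.
  by apply/negP; apply: n0; move: iL aL; rewrite /L; lia.
- by rewrite sp so !(card_run a gN og) // /L; lia.
by rewrite sp so !(card_run a gN og) // /L; lia.
Qed.

(** When [g *+ q = 0], a run of length [q] is the whole cyclic subgroup generated by [g]. *)
Lemma run_invariant N g q a w : fin_subgroup N -> ord_mod N g q -> g *+ q = 0 ->
  trfs (- (g *+ w)) (run g a q) = run g a q.
Proof.
move=> gN og gq; have [q0 _ _] := og.
have red i : g *+ (i %% q) = g *+ i.
  by rewrite {2}(divn_eq i q) mulrnDr mulnC mulrnA gq mul0rn add0r.
apply/fsetP => x; rewrite mem_trfs opprK; apply/runP/runP => -[i iq E].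
  exists ((i + w * q.-1) %% q)%N; first by rewrite ltn_mod.
  rewrite red mulrnDr addrAC -E -addrA -mulrnDr.
  rewrite -mulnS prednK // mulnC mulrnA gq mul0rn addr0 //.
exists ((i + w) %% q)%N; first by rewrite ltn_mod.
by rewrite red mulrnDr addrAC E.
Qed.

Lemma run_tile_down N g q : fin_subgroup N -> ord_mod N g q -> (2 < q)%N ->
  exists o z, [/\ tile N (adjoin N g q) o z, - z \in ssums o,
    (6 * #|` ssums o| <= 5 * #|` span2 o z|)%N &
    g *+ q = 0 -> trfs z (span2 o z) = span2 o z].
Proof.
move=> gN og q3; have [q0 qN qk] := og.
have n0 i : (0 < i < q)%N -> g *+ i != 0.
  by move=> /qk; apply: contraNneq => ->; exact: fin_subgroup0.
(* The second bound gives [6 (q - r) <= 5 q]. The third, with [2 a < L], gives [r + a < L], which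
   puts [- z = r g] in the run. *)
have [r [r0 rq rL]] : exists r, [/\ (0 < r)%N, (q <= 6 * r)%N &
    (2 * r <= q - r + (r == 1))%N].
  have [->|q3'] := eqVneq q 3%N; first by exists 1%N.
  by exists ((q - 1) %/ 3)%N; split; lia.
pose L := (q - r)%N.
have [|o [a [uo o0 so aL]]] := run_ssums (L := L) gN og; first by rewrite /L; lia.
have sp : span2 o (- (g *+ r)) = run g (a + r) q.
  by rewrite /span2 so run_extl /L ?subnK //; lia.
exists o, (- (g *+ r)); split.
- split=> //; first by rewrite oppr_eq0; apply: n0; lia.
  by rewrite sp; apply: run_coset_reps => //; rewrite /L in aL; lia.
- rewrite so opprK; apply/runP; exists (r + a)%N; last by rewrite mulrnDr addrK.
  by move: aL; rewrite /L; lia.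
- by rewrite sp so (card_run _ gN og) ?(card_run _ gN og) // /L; lia.
by move=> gq; rewrite sp (run_invariant _ _ gN og).
Qed.

End TileExistence.

(** * Existence of tiles *)

Section MissTiles.
Variable G : zmodType.
Implicit Types (A B C N M X Y Z W : {fset G}) (x y z t g : G) (s o : seq G).

Definition unbounded_orders := forall N Q, fin_subgroup N ->
  exists g q, (Q <= q)%N /\ ord_mod N g q.

(** The cyclic subgroup generated by [g] has order [q] and meets [N] only in 0. *)
Definition complemented_cycles := forall N, fin_subgroup N ->
  exists g q, [/\ ord_mod N g q, (2 < q)%N & g *+ q = 0].

Lemma ord_mod_dvd N g q n : fin_subgroup N -> ord_mod N g q -> g *+ n \in N -> (q %| n)%N.
Proof.
move=> gN [q0 qN qk]; rewrite {1}(divn_eq n q) mulrnDr mulnC mulrnA.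
rewrite fin_subgroupDl //; last exact: fin_subgroupMn.
move=> H; rewrite /dvdn.
case: posnP => // r0; have := qk (n %% q)%N; rewrite r0 ltn_mod q0 H.
by move=> /(_ isT).
Qed.

(* If the orders modulo some finite subgroup are bounded, then [G] has bounded exponent; as
   [2 G] is infinite, for some multiple [f] and some prime [p] the group [2 f G] has
   infinitely many elements of order [p], hence some outside any given finite subgroup. *)
Lemma orders_dichotomy :
  (forall g, exists2 M, fin_subgroup M & g \in M) ->
  (forall A, exists g, g *+ 2 \notin A) ->
  unbounded_orders \/ complemented_cycles.
Proof.
move=> cov H2; case: (pselect (unbounded_orders)) => [|nu]; [by left|right].
have [N0 [Q [gN0 HQ]]] : exists N0 Q, fin_subgroup N0 /\
    forall g q, ord_mod N0 g q -> (q < Q)%N.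
  apply: contrapT => H; apply: nu => N Q gN; apply: contrapT => H'; apply: H.
  exists N, Q; split => // g q og; rewrite ltnNge; apply/negP => Qq.
  by apply: H'; exists g, q.
pose P E := (0 < E)%N && `[< exists A, forall g, g *+ (2 * E) \in A >].
(* [P E] says that [2 E G] is finite. Every element has order below [Q] modulo [N0], so
   multiplication by a multiple of [Q!] carries it into [N0], where the factorial of the order of
   [N0] kills it. *)
have exP : exists E, P E.
  exists (2 * (Q `! * #|` N0| `!))%N; rewrite /P !muln_gt0 !fact_gt0 /=.
  apply/asboolP; exists [fset 0]%fset => g; rewrite inE !mulnA mulrnA.
  have [M gM gM'] := cov g; have [q og] := ord_mod_ex gN0 gM gM'.
  have qQ := HQ _ _ og.
  have : g *+ (2 * 2 * Q`!) \in N0.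
    have [q0 qN _] := og; have /dvdnP[c ->] : (q %| 2 * 2 * Q`!)%N.
      by rewrite dvdn_mull // dvdn_fact // q0 ltnW.
    by rewrite mulnC mulrnA fin_subgroupMn.
  move=> yN; set y := g *+ _ in yN *.
  have [n n0 [nM yn]] : exists2 n, (0 < n)%N & (n <= #|` N0|)%N /\ y *+ n = 0.
    exact: fin_subgroup_torsion.
  have /dvdnP[c ->] : (n %| #|` N0| `!)%N by rewrite dvdn_fact // n0.
  by rewrite mulnC mulrnA yn mul0rn.
have [E /andP[E0 /asboolP[A AE]] Emin] := ex_minnP exP.
have E1 : (1 < E)%N.
  rewrite ltn_neqAle E0 andbT; apply/negP => /eqP E1.
  by have [g] := H2 A; have := AE g; rewrite -E1 muln1 => ->.
pose p := pdiv E; pose f := (E %/ p)%N.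
have pp : prime p by apply: pdiv_prime.
have fE : (f * p = E)%N by rewrite divnK // pdiv_dvd.
have f0 : (0 < f)%N by move: E0; rewrite -fE muln_gt0 => /andP[].
have fltE : (f < E)%N by rewrite -fE -{1}[f]muln1 ltn_pmul2l // prime_gt1.
(* Otherwise, subtracting from [g] a chosen element with the same [2 E] multiple leaves an element
   killed by [2 E = 2 f p], whose [2 f] multiple is in [N]. Then [2 f G] is finite, against the
   minimality of [E]. *)
have key N : exists g, g *+ (2 * f) \notin N /\ g *+ (2 * f) *+ p = 0.
  apply: contrapT => H.
  pose h (a : G) : G := xget 0 [set g : G | g *+ (2 * E) = a].
  have : P f.
    rewrite /P f0; apply/asboolP.
    exists (addfs N [fset (h a *+ (2 * f))%R | a in A]%fset) => g.
    rewrite -(subrK (h (g *+ (2 * E)) *+ (2 * f)) (g *+ (2 * f))).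
    apply: mem_addfs; last by apply/imfsetP; exists (g *+ (2 * E)) => //=; apply: AE.
    rewrite -mulrnBl; apply: contrapT => /negP gN; apply: H.
    exists (g - h (g *+ (2 * E))); split=> //.
    rewrite -mulrnA -mulnA fE mulrnBl /h.
    by case: xgetP => [_ -> -> //|/(_ g)]; [rewrite subrr|case].
  by move=> /Emin; rewrite leqNgt fltE.
move=> N gN; have [g [gN' gp]] := key N.
(* Order 2 would be too small. For [p = 2] the element [f g] serves: [2 f g] is outside [N] and
   [4 f g = 0], so its order modulo [N] is 4. For odd [p] the element [2 f g] has order [p] modulo
   [N]. *)
have [p2|p2] := eqVneq p 2%N.
  exists (g *+ f); have [M gM gM'] := cov (g *+ f).
  have [q og] := ord_mod_ex gN gM gM'.
  have g4 : g *+ f *+ 4 = 0 by rewrite -[RHS]gp p2 -!mulrnA; congr (_ *+ _); lia.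
  have : (q %| 4)%N by apply: (ord_mod_dvd gN og); rewrite g4 fin_subgroup0.
  have [q0 qN _] := og.
  have q2 : ~~ (q %| 2)%N.
    apply/negP => /dvdnP[c E2]; move: gN'; rewrite mulnC mulrnA E2 mulnC mulrnA.
    by rewrite fin_subgroupMn.
  exists q; have q4 : q = 4%N.
    have : (q <= 4)%N by apply: dvdn_leq.
    by move: q2 H q0; clear; case: q => [|[|[|[|[|]]]]].
  by rewrite q4 in og *.
exists (g *+ (2 * f)), p.
have [M gM gM'] := cov (g *+ (2 * f)).
have [q og] := ord_mod_ex gN gM gM'.
have : (q %| p)%N by apply: (ord_mod_dvd gN og); rewrite gp fin_subgroup0.
have [q0 qN _] := og.
have q1 : q != 1%N by apply: contraNneq gN' => q1; move: qN; rewrite q1.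
move=> /(prime_nt_dvdP pp q1) qp; rewrite qp in og; split=> //.
by case: (even_prime pp) => [/eqP|op]; [rewrite (negbTE p2)|apply: odd_prime_gt2].
Qed.

(** The proportion of representatives missed by [ssums o] is at most [1 / k] and at least [1 / K].
    In the existence results [K] is independent of [N], so that down-moves shrink the density by a
    uniform factor. *)
Definition miss_tile N M o z k K :=
  [/\ fin_subgroup M, {subset N <= M}, tile N M o z,
    ((#|` span2 o z| - #|` ssums o|) * k <= #|` span2 o z|)%N &
    (#|` span2 o z| <= K * (#|` span2 o z| - #|` ssums o|))%N].

Lemma miss_tile_unbounded : unbounded_orders -> forall k, (1 < k)%N ->
  exists K, forall N, fin_subgroup N -> exists M o z, miss_tile N M o z k K.
Proof.
move=> unb k k1; exists (2 * k)%N => N gN.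
have [g [q [kq og]]] := unb N k gN; have [q0 qN qk] := og.
have n0 i : (0 < i < q)%N -> g *+ i != 0.
  by move=> /qk; apply: contraNneq => ->; exact: fin_subgroup0.
(* The number [r] of missed representatives among [q] satisfies [r k <= q < (r + 1) k <= 2 k r],
   whence [K = 2 k]. *)
pose r := (q %/ k)%N; pose L := (q - r)%N.
have r0 : (0 < r)%N by rewrite divn_gt0 // (ltn_trans _ k1).
have rk : (r * k <= q)%N by apply: leq_divM.
have rk2 : (q < r * k + k)%N by rewrite -mulSnr ltn_ceil // (ltn_trans _ k1).
have kr : (k <= r * k)%N by rewrite leq_pmull.
have r2 : (r * 2 <= q)%N by apply: leq_trans rk; rewrite leq_mul2l k1 orbT.
have [|o [a [uo o0 so aL]]] := run_ssums (L := L) gN og; first by rewrite /L; lia.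
have sp : span2 o (g *+ r) = run g a q.
  by rewrite /span2 so run_extr /L ?subnK //; lia.
exists (adjoin N g q), o, (g *+ r); split.
- exact: adjoin_subgroup.
- exact: sub_adjoin.
- split=> //; first by apply: n0; lia.
  by rewrite sp; apply: run_coset_reps => //; rewrite /L in aL; lia.
- by rewrite sp so !(card_run a gN og) // /L ?leq_subr // subKn //; lia.
rewrite sp so !(card_run a gN og) // /L ?leq_subr // subKn; last by lia.
by rewrite -mulnA [(k * r)%N]mulnC; lia.
Qed.

Lemma up_tile_ex : unbounded_orders \/ complemented_cycles ->
  forall N, fin_subgroup N -> exists M o z,
   [/\ fin_subgroup M, {subset N <= M}, tile N M o z, - z \notin ssums o &
    (4 * #|` span2 o z| <= 7 * #|` ssums o|)%N /\
    (4 * #|` ssums o| <= 3 * #|` span2 o z|)%N].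
Proof.
move=> H N gN.
(* The exceptional order 4 is avoided by an order of at least 5 in the first case, and is harmless
   in the second since [g *+ q = 0]. *)
have [g [q [og q3 q4]]] : exists g q, [/\ ord_mod N g q, (2 < q)%N &
    (q != 4)%N || (g *+ 4 == 0)].
  case: H => [/(_ N 5%N gN)[g [q [q5 og]]]|/(_ N gN)[g [q [og q3 gq]]]]; exists g, q.
    by split=> //; [lia|apply/orP; left; lia].
  split=> //; have [<-|//] := eqVneq q 4%N; by rewrite gq eqxx.
have [ o [z [tl zo h1 h2]]] := run_tile_up gN og q3 q4.
by exists (adjoin N g q), o, z; split=> //; [apply: adjoin_subgroup|apply: sub_adjoin].
Qed.

Lemma down_tile_ex : unbounded_orders \/ complemented_cycles ->
  forall N, fin_subgroup N -> exists M o z,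
   [/\ fin_subgroup M, {subset N <= M}, tile N M o z, - z \in ssums o &
    (6 * #|` ssums o| <= 5 * #|` span2 o z|)%N].
Proof.
move=> H N gN.
have [g [q [og q3]]] : exists g q, ord_mod N g q /\ (2 < q)%N.
  by case: H => [/(_ N 5%N gN)[g [q [q5 og]]]|/(_ N gN)[g [q [og q3 gq]]]]; exists g, q;
    split=> //; lia.
have [ o [z [tl zo h1 _]]] := run_tile_down gN og q3.
by exists (adjoin N g q), o, z; split=> //; [apply: adjoin_subgroup|apply: sub_adjoin].
Qed.

(** Since [span2 o z] is invariant under [z], translating the layer by [z] completes both its part
    over [ssums o'] and its part over [z' + ssums o']. *)
Lemma span2_layer M o z o' z' : fin_subgroup M -> trfs z (span2 o z) = span2 o z ->
  span2 (o ++ rcons o' (z' + z)) z = addfs (span2 o z) (span2 o' z').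
Proof.
move=> gM inv; set P := ssums o; set P' := ssums o'; set Q' := trfs z' P'.
have E : ssums (o ++ rcons o' (z' + z)) = layer o' z' P z.
  by rewrite ssums_cat layerE.
have Ez : trfs z (layer o' z' P z) =
    (addfs (trfs z P) P' `|` addfs (trfs z (trfs z P)) Q')%fset.
  by rewrite /layer trfsU !trfs_addfsl.
have E2 : addfs (span2 o z) Q' = (addfs (trfs z P) Q' `|` addfs (trfs z (trfs z P)) Q')%fset.
  by rewrite -inv /span2 trfsU addfsC addfsU ![addfs Q' _]addfsC.
rewrite {1}/span2 E Ez [span2 o' z']/span2 addfsU E2.
rewrite [addfs (span2 o z) P']addfsC /span2 addfsU -/P -/P' ![addfs P' _]addfsC
  /layer -/P -/P' -/Q'.
by apply/fsetP => x; rewrite !inE; do 4 case: (x \in _).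
Qed.

(* As the set of representatives is invariant under [z], repeated up-moves with [t = z] only
   fill in missing representatives; each of them divides their proportion by a factor
   between [7 / 6] and [2]. *)
Lemma miss_tile_complemented_step j N : complemented_cycles -> fin_subgroup N ->
  exists M o z, [/\ fin_subgroup M, {subset N <= M}, tile N M o z,
    trfs z (span2 o z) = span2 o z &
    (7 ^ j * (#|` span2 o z| - #|` ssums o|) <= 6 ^ j * #|` span2 o z|)%N /\
    (#|` span2 o z| <= 6 * 2 ^ j * (#|` span2 o z| - #|` ssums o|))%N].
Proof.
move=> cc gN; elim: j => [|j [M [ o [z [gM NM tl inv [h1 h2]]]]]].
  have [g [q [og q3 gq]]] := cc N gN.
  have [ o [z [tl zo h1 h2]]] := run_tile_down gN og q3.
  exists (adjoin N g q), o, z; split=> //.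
  - exact: adjoin_subgroup.
  - exact: sub_adjoin.
  - exact: h2.
  by rewrite !expn0; split; move: h1; lia.
have [M' [ o' [z' [gM' MM' tl' _ [b1 b2]]]]] := up_tile_ex (or_intror cc) gM.
have sE := @span2_layer M o z o' z' gM inv.
have [uo o0 z0 r] := tl; have [uo' o0' z0' r'] := tl'.
have zM := tile_mem tl.
have NM' : {subset N <= M'} by move=> x /NM /MM'.
exists M', (o ++ rcons o' (z' + z)), z; split=> //.
- split=> //.
  + rewrite cat_uniq uo (tile_rcons_uniq tl') // andbT /=; apply/hasPn => x.
    by move=> /(tile_rcons_disj gM tl' zM); apply: contraNN => /(tile_subo tl).
  + rewrite mem_cat negb_or o0 /=; apply/negP => /(tile_rcons_disj gM tl' zM).
    by rewrite fin_subgroup0.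
  by rewrite sE //; apply: coset_reps_comp r r'.
- by rewrite sE // trfs_addfsl inv.
have PM := tile_sub tl.
have YM : {subset span2 o z <= M} by case: r.
rewrite sE // (card_addfs_sub_coset_reps gM r' YM) //.
rewrite ssums_cat layerE (card_layer gM gM' MM' tl' PM zM) -/(span2 o z).
have /andP[c1 c2] := card_span2 o z; have /andP[c1' c2'] := card_span2 o' z'.
set y := #|` span2 o z| in h1 h2 c1 c2 *; set p := #|` ssums o| in h1 h2 c1 c2 *.
set y' := #|` span2 o' z'| in b1 b2 c1' c2' *; set p' := #|` ssums o'| in b1 b2 c1' c2' *.
(* [d] and [d'] count what the two tiles miss, [e] is the overlap of the second. Each of the [2 d']
   cosets without the union misses [d] representatives, which multiplies the missing proportion by
   [2 d' / (2 d' + e)]. *)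
have [d dE] : exists d, y = (p + d)%N by exists (y - p)%N; lia.
have [d' dE'] : exists d', y' = (p' + d')%N by exists (y' - p')%N; lia.
have [e eE] : exists e, p' = (d' + e)%N by exists (p' - d')%N; lia.
rewrite dE addKn in h1 h2; rewrite dE dE' !addKn eE.
have -> : (2 * (d' + e) - (d' + e + d') = e)%N by lia.
have -> : ((p + d) * (d' + e + d') - (p * (2 * d') + (p + d) * e) = d * (2 * d'))%N.
  rewrite (_ : (_ * (d' + e + d'))%N = p * (2 * d') + (p + d) * e + d * (2 * d'))%N ?addKn //.
  by ring.
have e1 : (14 * d' <= 6 * (2 * d' + e))%N by lia.
have e2 : (2 * d' + e <= 4 * d')%N by lia.
rewrite !expnS; split.
  have := leq_mul h1 e1.
  rewrite [X in (X <= _)%N -> _](_ : _ = 7 * 7 ^ j * (d * (2 * d')))%N; last by ring.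
  by move=> /leq_trans -> //; apply/eq_leq; ring.
have := leq_mul h2 e2.
rewrite [X in (_ <= X)%N -> _](_ : _ = 6 * (2 * 2 ^ j) * (d * (2 * d')))%N; last by ring.
by apply: leq_trans; apply/eq_leq; ring.
Qed.

Lemma miss_tile_complemented : complemented_cycles -> forall k,
  exists K, forall N, fin_subgroup N -> exists M o z, miss_tile N M o z k K.
Proof.
move=> cc k.
(* Bernoulli's inequality for [7 / 6]: after [j = 6 k] steps the missing proportion is at most
   [1 / (1 + k)]. *)
have bern j : ((6 + j) * 6 ^ j <= 7 ^ j * 6)%N.
  elim: j => [|j IH] //.
  rewrite !expnS; have := leq_mul (leqnn 7) IH; move: (6 ^ j)%N (7 ^ j)%N => u v; nia.
exists (6 * 2 ^ (6 * k))%N => N gN.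
have [M [ o [z [gM NM tl inv [h1 h2]]]]] := miss_tile_complemented_step (6 * k) cc gN.
exists M, o, z; split=> //.
have arith (u v d y : nat) : (0 < u)%N -> (v * d <= u * y)%N ->
    ((6 + 6 * k) * u <= v * 6)%N -> (d * k <= y)%N.
  move=> u0 h hb; rewrite -(leq_pmul2l u0) -(@leq_pmul2l 6) //.
  apply: leq_trans (_ : (6 * (v * d) <= _)%N); last by rewrite leq_pmul2l.
  by apply: leq_trans (_ : (d * ((6 + 6 * k) * u) <= _)%N); [lia|nia].
by apply: arith h1 (bern _); rewrite expn_gt0.
Qed.

End MissTiles.

(** * Densities *)

Section Density.
Variables (R : realType) (G : zmodType).
Implicit Types (A B C F N M X Y Z W : {fset G}) (x y z t g : G) (s o : seq G).

Definition rho N X : R := #|` X|%:R / #|` N|%:R.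

(** By inclusion-exclusion, the proportion of representatives lying both in [ssums o] and in its
    translate by [z]. *)
Definition overlap o z : R :=
  (2 * #|` ssums o|%:R - #|` span2 o z|%:R) / #|` span2 o z|%:R.

(* What [t + X] adds to [X], saturated by [N]: thanks to the saturation it does not grow
   when [X] is replaced by its union with [u + X], [u] in [N] ([bad_union_sub]). *)
Definition bad N t X : {fset G} := addfs (trfs t X `\` X)%fset N.

Lemma card_fin_gt0 N : fin_subgroup N -> 0 < #|` N|%:R :> R.
Proof. by move=> gN; rewrite ltr0n fin_subgroup_gt0. Qed.

Lemma rho_ge0 N X : 0 <= rho N X.
Proof. by rewrite divr_ge0. Qed.

Lemma rho_le N X Y : {subset X <= Y} -> rho N X <= rho N Y.
Proof.
move=> XY; rewrite ler_wpM2r ?invr_ge0 // ler_nat; apply: fsubset_leq_card.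
exact/fsubsetP.
Qed.

Lemma rho_self N : fin_subgroup N -> rho N N = 1.
Proof. by move=> gN; rewrite /rho divff // lt0r_neq0 // card_fin_gt0. Qed.

Lemma rho_le1 N X : fin_subgroup N -> {subset X <= N} -> rho N X <= 1.
Proof. by move=> gN XN; rewrite -(rho_self gN); apply: rho_le. Qed.

Lemma rho_trfs N t X : rho N (trfs t X) = rho N X.
Proof. by rewrite /rho card_trfs. Qed.

Lemma span2_gt0 o z : 0 < #|` span2 o z|%:R :> R.
Proof. by rewrite ltr0n cardfs_gt0; apply/fset0Pn; exists z; apply: mem_span2. Qed.

Lemma rho_fib N M Y Z : fin_subgroup N -> fin_subgroup M -> {subset N <= M} ->
  coset_reps N M Y -> {subset Z <= M} ->
  rho M Z = (\sum_(y <- Y) rho N (fib N Z y)) / #|` Y|%:R.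
Proof.
move=> gN gM NM r ZM; rewrite /rho (card_fib gN r ZM) (coset_reps_card gN r NM gM).
by rewrite -mulr_suml natrM invfM natr_sum mulrA mulrAC.
Qed.

Lemma rho_fib_bounds N M Y Z a b : fin_subgroup N -> fin_subgroup M -> {subset N <= M} ->
  coset_reps N M Y -> {subset Z <= M} ->
  (forall y, y \in Y -> a <= rho N (fib N Z y) <= b) -> a <= rho M Z <= b.
Proof.
move=> gN gM NM r ZM ab; rewrite (rho_fib gN gM NM r ZM).
have Y0 : 0 < #|` Y|%:R :> R.
  by rewrite ltr0n cardfs_gt0; apply/fset0Pn; exists 0; case: r.
have cE c : c * #|` Y|%:R = \sum_(y <- Y) c.
  by rewrite card_fset_sum1 natr_sum mulr_sumr; apply: eq_bigr => i _; rewrite mulr1.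
rewrite ler_pdivlMr // ler_pdivrMr // !cE.
by apply/andP; split; rewrite big_seq [X in _ <= X]big_seq; apply: ler_sum => y /ab/andP[].
Qed.

(** [K] is a union of cosets of [N], so its density is an average of slice densities. This controls
    the densities at all subgroups of the filtration between [N] and [M]. *)
Lemma rho_coset_bounds N K M Y Z a b : fin_subgroup N -> fin_subgroup K ->
  {subset N <= K} -> {subset K <= M} -> coset_reps N M Y ->
  (forall y, y \in Y -> a <= rho N (fib N Z y) <= b) -> a <= rho K (Z `&` K)%fset <= b.
Proof.
move=> gN gK NK KM r ab; have rK := coset_reps_cap gN gK NK KM r.
apply: (rho_fib_bounds gN gK NK rK) => [z|y]; first by rewrite inE => /andP[].
rewrite !inE => /andP[yY yK]; have -> : fib N (Z `&` K)%fset y = fib N Z y; last exact: ab.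
apply/fsetP => u; rewrite !mem_fib inE; case: (boolP (u \in N)) => //= uN.
by rewrite (fin_subgroupD gK yK (NK _ uN)) andbT.
Qed.

Lemma rho_addfs_reps N M Y X : fin_subgroup N -> fin_subgroup M -> {subset N <= M} ->
  coset_reps N M Y -> {subset X <= N} -> rho M (addfs X Y) = rho N X.
Proof.
move=> gN gM NM r XN; have YY : {subset Y <= Y} by [].
rewrite /rho (card_addfs_sub_coset_reps gN r XN YY) (coset_reps_card gN r NM gM).
have n0 := lt0r_neq0 (card_fin_gt0 gN).
have y0 : #|` Y|%:R != 0 :> R.
  by rewrite pnatr_eq0 -lt0n cardfs_gt0; apply/fset0Pn; exists 0; case: r.
by rewrite !natrM; field; rewrite y0 n0.
Qed.

Lemma fib0 N Z : fib N Z 0 = (Z `&` N)%fset.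
Proof. by apply/fsetP => u; rewrite mem_fib !inE add0r andbC. Qed.

Lemma overlap_bounds o z : 0 <= overlap o z <= 1.
Proof.
have := card_span2 o z; have := span2_gt0 o z; rewrite -(ler_nat R) -[(_ <= 2 * _)%N](ler_nat R).
rewrite natrM /overlap => y0 /andP[h1 h2]; rewrite divr_ge0 ?subr_ge0 //=.
by rewrite ler_pdivrMr // mul1r; lra.
Qed.

Lemma layer_addfs o z X t A : addfs (layer o z X t) A = layer o z (addfs X A) t.
Proof.
have ac B C : addfs (addfs B C) A = addfs (addfs B A) C.
  by rewrite -!addfsA [addfs C A]addfsC.
by rewrite /layer addfsC addfsU ![addfs A (addfs _ _)]addfsC !ac trfs_addfsl.
Qed.

Section Layers.
Variables (N M : {fset G}) (o : seq G) (z : G).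
Hypotheses (gN : fin_subgroup N) (gM : fin_subgroup M) (NM : {subset N <= M}).
Hypothesis tl : tile N M o z.

Lemma rho_layer X t : {subset X <= N} -> t \in N ->
  rho M (layer o z X t) =
    (1 - overlap o z) * rho N X + overlap o z * rho N (X `|` trfs t X)%fset.
Proof.
move=> XN tN; have [_ _ _ r] := tl.
rewrite /rho (card_layer gN gM NM tl XN tN) (coset_reps_card gN r NM gM).
have /andP[h1 h2] := card_span2 o z.
rewrite natrD !natrM !natrB // natrM /overlap.
have := card_fin_gt0 gN; have := span2_gt0 o z => /lt0r_neq0 y0 /lt0r_neq0 n0.
by field; rewrite y0 n0.
Qed.

Lemma rho_layer_ge X t : {subset X <= N} -> t \in N -> rho N X <= rho M (layer o z X t).
Proof.
move=> XN tN; rewrite rho_layer //; have /andP[ o0 o1] := overlap_bounds o z.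
have : rho N X <= rho N (X `|` trfs t X)%fset by apply: rho_le => x; rewrite inE => ->.
move: (rho _ _) (rho _ _) (overlap _ _) o0 o1 => a b c; nra.
Qed.

(** The representative 0 of [N] always lies in [ssums o], and lies in its translate by [z] exactly
    when [- z] is in [ssums o]. *)
Lemma layer_cap_up X t : {subset X <= N} -> t \in N -> - z \notin ssums o ->
  (layer o z X t `&` N)%fset = X.
Proof.
move=> XN tN zo; have [_ _ _ [_ r0 _ _]] := tl.
rewrite -fib0 (fib_layer gN tl XN tN r0) ssums0 mem_trfs sub0r (negbTE zo).
by rewrite fsetU0.
Qed.

Lemma layer_cap_down X t : {subset X <= N} -> t \in N -> - z \in ssums o ->
  (layer o z X t `&` N)%fset = (X `|` trfs t X)%fset.
Proof.
move=> XN tN zo; have [_ _ _ [_ r0 _ _]] := tl.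
by rewrite -fib0 (fib_layer gN tl XN tN r0) ssums0 mem_trfs sub0r zo.
Qed.

Lemma fib_bad K t X y : {subset K <= N} -> t \in N ->
  fib N (bad K t X) y = bad K t (fib N X y).
Proof.
by move=> KN tN; rewrite /bad addfsC fib_addfs // fibD fib_trfs // addfsC.
Qed.

Lemma bad_sub K t X : {subset K <= N} -> t \in N -> {subset X <= N} -> {subset bad K t X <= N}.
Proof.
move=> KN tN XN; apply: addfs_sub_group => // x; rewrite inE => /andP[_].
exact: trfs_sub_group.
Qed.

End Layers.

Lemma bad_trfs K u t X : bad K u (trfs t X) = trfs t (bad K u X).
Proof. by rewrite /bad trfs_addfsl trfsD !trfs_trfs addrC. Qed.

(** If [t] is in [K], a new element lies in [u + X] outside [X], or does so after subtracting [t],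
    which does not change its class modulo [K]. If [u = t], new elements lie in [2 t + X] outside
    [t + X], a translate of [t + X] outside [X]. *)
Lemma bad_union_sub K u t X : fin_subgroup K -> t \in K \/ u = t ->
  (#|` bad K u (X `|` trfs t X)%fset| <= #|` bad K u X|)%N.
Proof.
move=> gK [tK|->].
  apply: fsubset_leq_card; apply/fsubsetP => _ /addfsP[a [b [+ bK ->]]].
  rewrite !(inE, mem_trfs) negb_or => /andP[/andP[aX atX] /orP[auX|autX]].
    by apply: mem_addfs => //; rewrite inE aX mem_trfs.
  rewrite -(subrK t a) -addrA; apply: mem_addfs; last exact: fin_subgroupD.
  by rewrite inE atX mem_trfs addrAC.
rewrite -(card_trfs t (bad K t X)) -bad_trfs; apply: fsubset_leq_card.
apply: addfsS; last exact: fsubset_refl.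
apply/fsubsetP => a; rewrite !(inE, mem_trfs) negb_or => /andP[/andP[aX atX]].
by rewrite (negbTE atX) /= => ->.
Qed.

Lemma rho_bad_layer N M K o z u t X : fin_subgroup N -> fin_subgroup M ->
  {subset N <= M} -> tile N M o z -> fin_subgroup K -> {subset K <= N} ->
  u \in N -> t \in N -> {subset X <= N} -> t \in K \/ u = t ->
  rho M (bad K u (layer o z X t)) <= rho N (bad K u X).
Proof.
move=> gN gM NM tl gK KN uN tN XN tu; have [_ _ _ r] := tl.
have KM : {subset K <= M} by move=> x /KN /NM.
have LM := layer_sub gN gM NM tl XN tN.
have BM : {subset bad K u (layer o z X t) <= M} by apply: bad_sub => //; apply: NM.
suff /andP[] : 0 <= rho M (bad K u (layer o z X t)) <= rho N (bad K u X) by [].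
apply: (rho_fib_bounds gN gM NM r BM) => y yY; rewrite rho_ge0 /= (fib_bad gN) //.
have [->|->|->] := fib_layer_cases gN tl XN tN yY; rewrite ?bad_trfs ?rho_trfs //.
by rewrite ler_wpM2r ?invr_ge0 // ler_nat; apply: bad_union_sub.
Qed.

Lemma bad_addfs_sub K u X V : (bad K u (addfs X V) `<=` addfs (bad K u X) V)%fset.
Proof.
apply/fsubsetP => _ /addfsP[a [b [+ bK ->]]]; rewrite inE trfs_addfsl => /andP[aXV].
move=> /addfsP[c [d [cX dV aE]]]; rewrite aE addrAC; apply: mem_addfs => //.
apply: mem_addfs => //; rewrite inE cX andbT; apply: contraNN aXV => cX'.
by rewrite aE; apply: mem_addfs.
Qed.

Lemma card_bad_addfs K u X V : (#|` bad K u (addfs X V)| <= #|` bad K u X| * #|` V|)%N.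
Proof.
by apply: leq_trans (card_addfs_le _ _); apply/fsubset_leq_card/bad_addfs_sub.
Qed.

(** A new element is congruent modulo [K] to an element of [u + ssums o] outside [ssums o], as [X]
    lies in [K]. *)
Lemma card_bad_tile K u X o : fin_subgroup K -> {subset X <= K} ->
  (#|` bad K u (addfs X (ssums o))| <= (#|` span2 o u| - #|` ssums o|) * #|` K|)%N.
Proof.
move=> gK XK.
have -> : (#|` span2 o u| - #|` ssums o|)%N = #|` (trfs u (ssums o) `\` ssums o)%fset|.
  rewrite -cardfsDS ?fsubsetUl //; congr #|` _|; apply/fsetP => x; rewrite !inE.
  by case: (x \in ssums o).
apply: leq_trans (card_addfs_le _ _); apply/fsubset_leq_card/fsubsetP.
move=> _ /addfsP[a [b [+ bK ->]]]; rewrite inE addfsC trfs_addfsl => /andP[aXV].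
move=> /addfsP[c [d [cX dV aE]]]; rewrite aE -addrA; apply: mem_addfs.
  rewrite inE cX andbT; apply: contraNN aXV => cX'.
  by rewrite aE; apply: mem_addfs.
by apply: fin_subgroupD => //; apply: XK.
Qed.

Lemma rho_union_bad N K t X : fin_subgroup K ->
  rho N (X `|` trfs t X)%fset <= rho N X + rho N (bad K t X).
Proof.
move=> gK; rewrite -mulrDl ler_wpM2r ?invr_ge0 // -natrD ler_nat.
have := card_addfs_ge (trfs t X `\` X)%fset (fin_subgroup0 gK); rewrite -/(bad K t X).
rewrite cardfsU cardfsD [(trfs t X `&` X)%fset]fsetIC.
by have := fsubset_leq_card (fsubsetIr X (trfs t X)); lia.
Qed.

End Density.

(** * Moving the density along the filtration *)

Section Filtration.
Variables (R : realType) (G : zmodType) (Gf : nat -> {fset G}).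
Implicit Types (A B C F N M X Y Z W : {fset G}) (x y z t g : G) (s o : seq G).
Implicit Types (n m i j k : nat) (e lo hi v b c : R).

Hypothesis gG : forall i, fin_subgroup (Gf i).
Hypothesis GS : forall i, {subset Gf i <= Gf i.+1}.
Hypothesis Gcov : forall x, exists i, x \in Gf i.
Hypothesis dich : unbounded_orders G \/ complemented_cycles G.

Notation rhoG n X := (rho R (Gf n) X).

Lemma Gf_mono i j : (i <= j)%N -> {subset Gf i <= Gf j}.
Proof.
move=> /subnKC <-; elim: (j - i)%N => [|k IH] x; first by rewrite addn0.
by move=> /IH; rewrite addnS => /GS.
Qed.

Lemma Gf_fset n A : exists2 m, (n < m)%N & {subset A <= Gf m}.
Proof.
suff [m mA] : exists m, {subset (A : seq G) <= Gf m}.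
  exists (maxn n.+1 m); first by rewrite leq_max leqnn.
  by move=> x /mA; apply: Gf_mono; rewrite leq_maxr.
elim: (A : seq G) => [|x s [m IH]]; first by exists 0%N.
have [i xi] := Gcov x; exists (maxn i m) => y; rewrite inE => /orP[/eqP ->|/IH].
  by apply: Gf_mono xi; rewrite leq_maxl.
by apply: Gf_mono; rewrite leq_maxr.
Qed.

Definition dens s j : R := rhoG j (ssums s `&` Gf j)%fset.

Definition state n s := uniq s /\ {subset s <= Gf n}.

Definition extends n s m s' :=
  [/\ (n <= m)%N, state m s', {subset s <= s'} & (ssums s' `&` Gf n)%fset = ssums s].

Definition drift e lo hi n s m s' :=
  [/\ extends n s m s',
      forall j, (n <= j <= m)%N -> lo <= dens s' j <= hi &
      forall j, (n <= j < m)%N -> `|dens s' j.+1 - dens s' j| <= e].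

Lemma state_sub n s : state n s -> {subset ssums s <= Gf n}.
Proof. by move=> [_ sG]; apply: ssums_sub. Qed.

Lemma densE n s : state n s -> dens s n = rhoG n (ssums s).
Proof.
move=> /state_sub sG; rewrite /dens; congr (rho _ _ _); apply/fsetP => x.
by rewrite inE; case: (boolP (x \in ssums s)) => // /sG ->.
Qed.

Lemma dens01 s j : 0 <= dens s j <= 1.
Proof. by rewrite rho_ge0 rho_le1 // => x; rewrite inE => /andP[]. Qed.

Lemma extends_dens n s m s' j : extends n s m s' -> (j <= n)%N -> dens s' j = dens s j.
Proof.
move=> [_ _ _ E] jn; rewrite /dens -E; congr (rho _ _ _); apply/fsetP => x.
rewrite !inE -andbA; case: (boolP (x \in Gf j)) => [xj|]; last by rewrite !andbF.
by rewrite (Gf_mono jn xj).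
Qed.

Lemma drift_refl e lo hi n s : 0 <= e -> state n s -> lo <= dens s n <= hi ->
  drift e lo hi n s n s.
Proof.
move=> e0 st d; split.
- split=> //; apply/fsetP => x; rewrite inE.
  by case: (boolP (x \in ssums s)) => // /(state_sub st) ->.
- by move=> j; rewrite -eqn_leq => /eqP <-.
by move=> j /andP[nj jn]; have := leq_ltn_trans nj jn; rewrite ltnn.
Qed.

Lemma drift_trans e lo hi n s m s' l s'' :
  drift e lo hi n s m s' -> drift e lo hi m s' l s'' -> drift e lo hi n s l s''.
Proof.
move=> [ex b1 d1] [ex' b2 d2]; have E j := extends_dens (j := j) ex'.
have [nm st ss sE] := ex; have [ml st' ss' sE'] := ex'; split.
- split=> //; first exact: leq_trans ml.
    by move=> x /ss /ss'.
  rewrite -sE -sE'; apply/fsetP => x; rewrite !inE -andbA.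
  by case: (boolP (x \in Gf n)) => [/(Gf_mono nm) ->|]; rewrite ?andbF.
- move=> j /andP[nj jl]; case: (leqP j m) => jm; last by apply: b2; rewrite (ltnW jm).
  by rewrite E //; apply: b1; rewrite nj.
move=> j /andP[nj jl]; case: (leqP m j) => jm; first by apply: d2; rewrite jm.
by rewrite !E ?(ltnW jm) //; apply: d1; rewrite nj.
Qed.

Lemma drift_weaken e lo hi e' lo' hi' n s m s' : e <= e' -> lo' <= lo -> hi <= hi' ->
  drift e lo hi n s m s' -> drift e' lo' hi' n s m s'.
Proof.
move=> ee ll hh [ex b d]; split=> // j jn.
  by have /andP[h1 h2] := b j jn; rewrite (le_trans ll h1) (le_trans h2 hh).
exact: le_trans (d j jn) ee.
Qed.

Lemma drift_state e lo hi n s m s' : drift e lo hi n s m s' -> state m s'.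
Proof. by case=> -[]. Qed.

Lemma drift_of_bounds e a n s m s' : extends n s m s' ->
  (forall j, (n <= j <= m)%N -> a <= dens s' j <= a + e) ->
  drift e a (a + e) n s m s'.
Proof.
move=> ex b; split=> // j /andP[nj jm].
have /andP[h1 h2] : a <= dens s' j <= a + e by apply: b; rewrite nj ltnW.
have /andP[h3 h4] : a <= dens s' j.+1 <= a + e.
  by apply: b; rewrite jm (leq_trans nj (leqnSn j)).
by rewrite ler_distl; apply/andP; split; lra.
Qed.

(** * Tiles between members of the filtration, and up-moves *)

Lemma up_tile_filt n : exists m o z, [/\ (n < m)%N, tile (Gf n) (Gf m) o z,
  - z \notin ssums o & 7^-1 <= overlap R o z].
Proof.
have [M [ o [z [gM NM tl zo [h1 _]]]]] := up_tile_ex dich (gG n).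
have [m nm Mm] := Gf_fset n M.
have [ o' [tl' zE _ [c c0 [cP cY]]]] := tile_ext (gG n) gM (gG m) NM Mm tl.
exists m, o', z; split; rewrite ?zE //.
(* The bound [4 |span2 o z| <= 7 |ssums o|] gives an overlap of at least [2 * 4 / 7 - 1]; the
   extension to [o'] preserves the ratio. *)
rewrite /overlap ler_pdivlMr ?span2_gt0 // cP cY !natrM.
move: h1; rewrite -(ler_nat R) !natrM.
have : 0 < c%:R :> R by rewrite ltr0n.
set x : R := c%:R; set y : R := #|` ssums o|%:R; set w : R := #|` span2 o z|%:R.
by clearbody x y w; nra.
Qed.

Lemma down_tile_filt n : exists m o z, [/\ (n < m)%N, tile (Gf n) (Gf m) o z,
  - z \in ssums o & overlap R o z <= 2 / 3].
Proof.
have [M [ o [z [gM NM tl zo h1]]]] := down_tile_ex dich (gG n).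
have [m nm Mm] := Gf_fset n M.
have [ o' [tl' zE _ [c c0 [cP cY]]]] := tile_ext (gG n) gM (gG m) NM Mm tl.
exists m, o', z; split; rewrite ?zE //.
rewrite /overlap ler_pdivrMr ?span2_gt0 // cP cY !natrM.
move: h1; rewrite -(ler_nat R) !natrM.
have : 0 < c%:R :> R by rewrite ltr0n.
set x : R := c%:R; set y : R := #|` ssums o|%:R; set w : R := #|` span2 o z|%:R.
by clearbody x y w; nra.
Qed.

Lemma miss_tile_filt e : 0 < e -> exists2 c : R, 0 < c & forall n, exists m o z,
  [/\ (n < m)%N, tile (Gf n) (Gf m) o z,
    (#|` span2 o z|%:R - #|` ssums o|%:R <= e * #|` span2 o z|%:R :> R) &
    c * #|` span2 o z|%:R <= #|` span2 o z|%:R - #|` ssums o|%:R].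
Proof.
move=> e0; pose k := (Num.truncn e^-1).+2.
have ke : 1 <= e * k%:R.
  rewrite mulrC -ler_pdivrMr // div1r /k -natr1 -[X in X%:R]/(Num.truncn e^-1).+1.
  by have := truncnS_gt e^-1; lra.
have [K HK] : exists K, forall N, fin_subgroup N -> exists M o z, miss_tile N M o z k K.
  by case: dich => [u|c]; [apply: miss_tile_unbounded|apply: miss_tile_complemented].
exists (K.+1%:R^-1) => [|n]; first by rewrite invr_gt0 ltr0n.
have [M [ o [z [gM NM tl h1 h2]]]] := HK _ (gG n).
have [m nm Mm] := Gf_fset n M.
have [ o' [tl' _ _ [c c0 [cP cY]]]] := tile_ext (gG n) gM (gG m) NM Mm tl.
have /andP[h3 _] := card_span2 o z.
exists m, o', z; split=> //; rewrite cP cY !natrM.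
  move: h1; rewrite -(ler_nat R) natrM natrB //.
  have : 0 < c%:R :> R by rewrite ltr0n.
  have : #|` ssums o|%:R <= #|` span2 o z|%:R :> R by rewrite ler_nat.
  set x : R := c%:R; set q : R := k%:R in ke *; set y : R := #|` ssums o|%:R.
  set w : R := #|` span2 o z|%:R; clearbody x q y w => yw x0 h.
  have E : w - y <= e * w.
    apply: le_trans (_ : e * ((w - y) * q) <= _); last by rewrite ler_wpM2l // ltW.
    by rewrite mulrCA ler_peMr // subr_ge0.
  by rewrite -mulrBl mulrA ler_wpM2r // ltW.
rewrite mulrC ler_pdivrMr ?ltr0n // -mulrBl -mulrA.
have : (#|` span2 o z|%:R <= (#|` span2 o z|%:R - #|` ssums o|%:R) * K.+1%:R :> R).
  rewrite -natrB // -natrM ler_nat (leq_trans h2) // mulnC leq_mul2l leqnSn orbT //.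
by move=> h; rewrite [c%:R * _]mulrC mulrA ler_wpM2r.
Qed.

(* A pair [(k, t)] of [L] records a loss, suffered between [Gf k] and a later subgroup, which
   up-moves with the element [t] recover. The losses are recovered in the order of [L], and
   the second condition keeps the first one valid for the rest of the list. *)
Definition chain e n X (L : seq (nat * G)) :=
  (forall p, p \in L -> (p.1 <= n)%N /\ rhoG n (bad (Gf p.1) p.2 X) <= e) /\
  pairwise (fun p q => p.2 \in Gf q.1) L.

(* Either condition bounds the effect of one up-move on the density by [e]. *)
Definition ctl e n X (L : seq (nat * G)) := 1 - e <= rhoG n X \/ chain e n X L.

Definition targets n (L : seq (nat * G)) :=
  forall p, p \in L -> p.2 \in Gf n /\ p.2 != 0.

(** The last conclusion, for any [F], lets the same move be measured on the set enlarged by the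
    targets still to be treated. *)
Lemma up_once e n s p L : 0 <= e -> state n s -> targets n (p :: L) ->
  ctl e n (ssums s) (p :: L) -> exists m s',
  [/\ drift e (dens s n) (dens s n + e) n s m s', (n < m)%N,
    ctl e m (ssums s') (p :: L) &
    forall F, {subset F <= Gf n} ->
      6 / 7 * rhoG n (addfs (ssums s) F) +
      1 / 7 * rhoG n (addfs (ssums s `|` trfs p.2 (ssums s))%fset F)
        <= rhoG m (addfs (ssums s') F)].
Proof.
move=> e0 st tg ct; have [tn t0] : p.2 \in Gf n /\ p.2 != 0 by apply: tg; rewrite inE eqxx.
have [m [ o [z [nm tl zo ov]]]] := up_tile_filt n.
set t := p.2 in tn t0 *; set X := ssums s in ct *.
have XN : {subset X <= Gf n} by apply: state_sub.
have NM : {subset Gf n <= Gf m} by apply: Gf_mono; apply: ltnW.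
have gN := gG n; have gM := gG m; have [_ _ _ r] := tl; have [us sN] := st.
exists m, (s ++ rcons o (z + t)).
have XE : ssums (s ++ rcons o (z + t)) = layer o z X t by rewrite ssums_cat layerE.
have tXN : {subset trfs t X <= Gf n} by apply: trfs_sub_group.
have step : rhoG n (X `|` trfs t X)%fset <= rhoG n X + e.
  case: ct => [h|[h _]].
    suff : rhoG n (X `|` trfs t X)%fset <= 1 by lra.
    by apply: rho_le1 => // x; rewrite inE => /orP[/XN|/tXN].
  have [_ h1] := h p (mem_head _ _).
  by apply: le_trans (rho_union_bad R _ t X (gG p.1)) _; rewrite lerD2l.
have st' : state m (s ++ rcons o (z + t)).
  split.
    rewrite cat_uniq us (tile_rcons_uniq tl) // andbT /=; apply/hasPn => x.
    by move=> /(tile_rcons_disj gN tl tn); apply: contraNN => /sN.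
  move=> x; rewrite mem_cat => /orP[/sN/NM //|].
  exact: (tile_rcons_sub gM NM tl).
have ex : extends n s m (s ++ rcons o (z + t)).
  split=> //; first exact: ltnW.
    by move=> x xs; rewrite mem_cat xs.
  by rewrite XE; apply: (layer_cap_up gN tl).
split=> //.
- apply: drift_of_bounds => // j /andP[nj jm]; rewrite (densE st) /dens XE.
  apply: (rho_coset_bounds gN (gG j) (Gf_mono nj) (Gf_mono jm) r) => y yY.
  have UX : rhoG n X <= rhoG n (X `|` trfs t X)%fset by apply: rho_le => x; rewrite inE => ->.
  have [->|->|->] := fib_layer_cases gN tl XN tn yY; rewrite ?rho_trfs ?lexx ?lerDl //.
  by rewrite UX.
- rewrite XE; case: ct => [h|[h pw]]; [left|right].
    by apply: le_trans h _; apply: (rho_layer_ge R gN gM NM tl).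
  split=> // q qL; have [qn h1] := h q qL; split; first exact: leq_trans (ltnW nm).
  apply: le_trans h1; have [tq _] := tg q qL.
  apply: (rho_bad_layer _ gN gM NM tl) => //; first exact: Gf_mono.
  (* For the pair in use [u = t]; for a later pair [q], the second condition of [chain] puts [t] in
     [Gf q.1]. These are the two cases of [bad_union_sub]. *)
  move: qL; rewrite inE => /orP[/eqP ->|qL]; [by right|left].
  by move: pw => /= /andP[/allP/(_ q qL)].
move=> F FN; rewrite XE layer_addfs.
have XF : {subset addfs X F <= Gf n} by apply: addfs_sub_group.
rewrite (rho_layer R gN gM NM tl XF tn).
have -> : addfs (X `|` trfs t X)%fset F = (addfs X F `|` trfs t (addfs X F))%fset.
  by rewrite addfsC addfsU trfs_addfsl ![addfs F _]addfsC.
have : rhoG n (addfs X F) <= rhoG n (addfs X F `|` trfs t (addfs X F))%fset.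
  by apply: rho_le => x; rewrite inE => ->.
move: (overlap _ _ _) ov => w ov; move: (rho _ _ _) (rho _ _ _) => a b; nra.
Qed.

(** Adding this set to [ssums s] gives the ideal outcome of recovering all losses in [L]; its
    density is the level that up-moves can approach. *)
Definition tgt_sums (L : seq (nat * G)) := ssums (map snd L).

Lemma tgt_sums_sub n L : targets n L -> {subset tgt_sums L <= Gf n}.
Proof. by move=> tg; apply: ssums_sub => // _ /mapP[p /tg[h _] ->]. Qed.

Lemma targets_mono n m L : (n <= m)%N -> targets n L -> targets m L.
Proof. by move=> nm tg p /tg[h1 h2]; split=> //; apply: Gf_mono h1. Qed.

(** Repeated up-moves with [p.2] shrink the allowance below [b] by a factor [6 / 7] each, starting
    from [b - 1 <= 0]. They stop as soon as the density reaches [v], with an overshoot of at most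
    [e]. *)
Lemma up_phase e lo v b n s p L k : 0 <= e -> b <= 1 -> state n s -> targets n (p :: L) ->
  ctl e n (ssums s) (p :: L) -> b <= rhoG n (addfs (ssums s) (tgt_sums (p :: L))) ->
  lo <= dens s n <= v + e -> exists m s',
  drift e lo (v + e) n s m s' /\
  (v <= dens s' m \/ [/\ ctl e m (ssums s') (p :: L) &
    b - (6 / 7) ^+ k <= rhoG m (addfs (ssums s') (tgt_sums L))]).
Proof.
move=> e0 b1 st tg ct hb hd.
suff [m [s' [P H]]] : exists m s', drift e lo (v + e) n s m s' /\
    (v <= dens s' m \/ [/\ ctl e m (ssums s') (p :: L),
      b <= rhoG m (addfs (ssums s') (tgt_sums (p :: L))) &
      b - (6 / 7) ^+ k <= rhoG m (addfs (ssums s') (tgt_sums L))]).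
  by exists m, s'; split=> //; case: H => [h|[h1 h2 h3]]; [left|right].
elim: k => [|k [m [s' [P [h|[ct' hb' hk]]]]]].
- exists n, s; split; first exact: drift_refl.
  right; split=> //; rewrite expr0; have := rho_ge0 R (Gf n) (addfs (ssums s) (tgt_sums L)).
  by lra.
- by exists m, s'; split=> //; left.
have [h|h] := leP v (dens s' m); first by exists m, s'; split=> //; left.
have st' := drift_state P; have [[nm _ _ _] bd _] := P.
have tg' := targets_mono nm tg.
have [l [s'' [P' ml ct'' hF]]] := up_once e0 st' tg' ct'.
have /andP[b1' b2'] : lo <= dens s' m <= v + e by apply: bd; rewrite nm leqnn.
exists l, s''; split.
  apply: drift_trans P _; apply: drift_weaken P' => //; rewrite ?lerD2r //.
  exact: ltW.
right; split=> //.
  have FN := tgt_sums_sub tg'.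
  apply: le_trans (hF _ FN).
  have : rhoG m (addfs (ssums s') (tgt_sums (p :: L))) <=
         rhoG m (addfs (ssums s' `|` trfs p.2 (ssums s'))%fset (tgt_sums (p :: L))).
    by apply: rho_le; apply/fsubsetP/addfsS => //; apply/fsubsetP => x; rewrite inE => ->.
  by move: hb'; lra.
have FN : {subset tgt_sums L <= Gf m}.
  by apply: tgt_sums_sub => q qL; apply: tg'; rewrite inE qL orbT.
apply: le_trans (hF _ FN); rewrite exprS.
have E : addfs (ssums s' `|` trfs p.2 (ssums s'))%fset (tgt_sums L) =
    addfs (ssums s') (tgt_sums (p :: L)).
  rewrite /tgt_sums /= addfsU -trfs_addfsr trfs_addfsl addfsC addfsU.
  by rewrite ![addfs (ssums (map _ _)) _]addfsC.
by rewrite E; move: hb' hk; lra.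
Qed.

(** The targets are treated one after the other, half of the remaining error being spent on each; at
    the end only the density itself is left. *)
Lemma up_list e lo v b dl n s L : 0 <= e -> b <= 1 -> 0 < dl -> state n s -> targets n L ->
  ctl e n (ssums s) L -> b <= rhoG n (addfs (ssums s) (tgt_sums L)) ->
  lo <= dens s n <= v + e -> exists m s',
  drift e lo (v + e) n s m s' /\ (v <= dens s' m \/ b - dl <= dens s' m).
Proof.
move=> e0; elim: L b dl n s => [|p L IH] b dl n s b1 dl0 st tg ct hb hd.
  exists n, s; split; first exact: drift_refl.
  right; rewrite (densE st); move: hb; rewrite /tgt_sums /= addfs0; lra.
have [k hk] : exists k, (6 / 7 : R) ^+ k <= dl / 2.
  have c1 : `|6 / 7 : R| < 1 by rewrite ger0_norm; lra.
  have dl2 : 0 < dl / 2 by lra.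
  have := cvg_expr c1; move=> /cvgrPdist_le /(_ _ dl2) [k _ /(_ k (leqnn k))].
  by rewrite /= sub0r normrN => h; exists k; apply: le_trans h; apply: ler_norm.
have [m [s' [P [h|[ct' hb']]]]] := up_phase k e0 b1 st tg ct hb hd.
  by exists m, s'; split=> //; left.
have st' := drift_state P; have [[nm _ _ _] bd _] := P.
have tg' : targets m L.
  by move=> q qL; apply: (targets_mono nm tg); rewrite inE qL orbT.
have ct'' : ctl e m (ssums s') L.
  case: ct' => [h|[h pw]]; [by left|right; split].
    by move=> q qL; apply: h; rewrite inE qL orbT.
  by move: pw => /= /andP[].
have hb'' : b - dl / 2 <= rhoG m (addfs (ssums s') (tgt_sums L)) by move: hb' hk; lra.
have hd' : lo <= dens s' m <= v + e by apply: bd; rewrite nm leqnn.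
have b1' : b - dl / 2 <= 1 by lra.
have dl1 : 0 < dl / 2 by lra.
have [m' [s'' [P' H]]] := IH _ _ m s' b1' dl1 st' tg' ct'' hb'' hd'.
exists m', s''; split; first exact: drift_trans P'.
by case: H => H; [left|right; lra].
Qed.

(** * Down-moves and cycles *)

Lemma addfs_union A B F : addfs (A `|` B)%fset F = (addfs A F `|` addfs B F)%fset.
Proof. by rewrite addfsC addfsU ![addfs F _]addfsC. Qed.

Lemma rho_ssums_addfs X o N M t : fin_subgroup N -> fin_subgroup M -> {subset N <= M} ->
  tile N M o t -> {subset X <= N} ->
  rho R M (addfs X (ssums o)) = rho R N X * (#|` ssums o|%:R / #|` span2 o t|%:R).
Proof.
move=> gN gM NM tl XN; have [_ _ _ r] := tl.
rewrite /rho (card_addfs_sub_coset_reps gN r XN); last exact: ssums_span2.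
rewrite (coset_reps_card gN r NM gM) !natrM.
have n0 := lt0r_neq0 (card_fin_gt0 R gN); have y0 := lt0r_neq0 (span2_gt0 R o t).
by field; rewrite n0 y0.
Qed.

(* A tile [(o1, t)] from [Gf n] to [Gf m1] that misses few representatives is followed by a
   tile [(o2, z)] with [- z] in [ssums o2] and with [z + t]: the zero coset of [Gf m1] then
   receives both [X + ssums o1] and its translate by [t], which hides the loss from all the
   subgroups below [Gf m1], while other cosets of [Gf m1] do suffer it. *)
Lemma down_once e : 0 < e -> exists2 c : R, 0 <= c < 1 & forall n s L,
  state n s -> targets n L -> chain e n (ssums s) L -> exists m s' p,
  [/\ drift e (dens s n - e) (dens s n) n s m s', dens s' m <= c * dens s n,
    targets m (rcons L p), chain e m (ssums s') (rcons L p) &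
    rhoG n (addfs (ssums s) (tgt_sums L)) <=
    rhoG m (addfs (ssums s') (tgt_sums (rcons L p)))].
Proof.
move=> e0; have [c0 c00 Hmiss] := miss_tile_filt e0.
have c01 : c0 <= 1.
  have [m [ o [z [_ _ _ h]]]] := Hmiss 0%N; rewrite -(ler_pM2r (span2_gt0 R o z)) mul1r.
  by apply: le_trans h _; rewrite gerBl.
(* With overlap [w <= 2 / 3] of the second tile and covered proportion [q <= 1 - c0] of the first,
   the density is multiplied by [(1 - w) q + w <= 1 - c0 / 3]. *)
exists (1 - c0 / 3); first by apply/andP; split; lra.
move=> n s L st tg [ch pw].
have [m1 [ o1 [t [nm1 tl1 h1 h2]]]] := Hmiss n.
have [m [ o2 [z [m1m tl2 zo ov]]]] := down_tile_filt m1.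
have NM1 : {subset Gf n <= Gf m1} by apply: Gf_mono; apply: ltnW.
have M1M : {subset Gf m1 <= Gf m} by apply: Gf_mono; apply: ltnW.
have NM : {subset Gf n <= Gf m} by move=> x /NM1 /M1M.
have gN := gG n; have gM1 := gG m1; have gM := gG m.
have [uo1 _ t0 r1] := tl1; have [uo2 _ z0 r2] := tl2; have [us sN] := st.
set X := ssums s in ch *; set X1 := addfs X (ssums o1).
have XN : {subset X <= Gf n} by apply: state_sub.
have XM1 : {subset X <= Gf m1} by move=> x /XN /NM1.
have tM1 : t \in Gf m1 by apply: tile_mem tl1.
have P1M : {subset ssums o1 <= Gf m1} by apply: tile_sub tl1.
have X1M : {subset X1 <= Gf m1} by apply: addfs_sub_group.
pose s' := s ++ o1 ++ rcons o2 (z + t).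
have sE : ssums s' = layer o2 z X1 t by rewrite /s' catA ssums_cat layerE ssums_cat.
have X2E : (X1 `|` trfs t X1)%fset = addfs X (span2 o1 t).
  by rewrite /span2 addfsU trfs_addfsr.
have capM1 : (ssums s' `&` Gf m1)%fset = addfs X (span2 o1 t).
  by rewrite sE (layer_cap_down gM1 tl2) // X2E.
have fibX y : y \in span2 o1 t -> fib (Gf n) (addfs X (span2 o1 t)) y = X.
  by move=> yY; rewrite (fib_reps gN tl1) // yY.
have st' : state m s'.
  split.
    rewrite cat_uniq us /= cat_uniq uo1 (tile_rcons_uniq tl2) //= andbT.
    apply/andP; split; apply/hasPn => x.
      rewrite mem_cat => /orP[/(tile_disj tl1)|/(tile_rcons_disj gM1 tl2 tM1)].
        by apply: contraNN => /sN.
      by apply: contraNN => /sN /NM1.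
    by move=> /(tile_rcons_disj gM1 tl2 tM1); apply: contraNN => /(tile_subo tl1).
  move=> x; rewrite !mem_cat => /orP[/sN/NM //|/orP[/(tile_subo tl1)/M1M //|]].
  exact: (tile_rcons_sub gM M1M tl2).
have ex : extends n s m s'.
  split=> //; first by apply: ltnW; apply: ltn_trans m1m.
    by move=> x xs; rewrite mem_cat xs.
  have -> : (ssums s' `&` Gf n)%fset = ((ssums s' `&` Gf m1) `&` Gf n)%fset.
    apply/fsetP => x; rewrite !inE -andbA.
    by case: (boolP (x \in Gf n)) => [/NM1 ->|]; rewrite ?andbF.
  by rewrite capM1 -fib0 fibX //; case: r1.
have dE := densE st.
have d0 : 0 <= rhoG n X by apply: rho_ge0.
have d1 : rhoG n X <= 1 by apply: rho_le1.
have rX2 : rhoG m1 (addfs X (span2 o1 t)) = rhoG n X by apply: (rho_addfs_reps R gN gM1 NM1 r1).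
set q : R := #|` ssums o1|%:R / #|` span2 o1 t|%:R.
have rX1 : rhoG m1 X1 = rhoG n X * q by apply: (rho_ssums_addfs gN gM1 NM1 tl1).
have y0 := span2_gt0 R o1 t.
have q1 : q <= 1 - c0 by rewrite /q ler_pdivrMr //; move: h2; lra.
have q2 : 1 - e <= q by rewrite /q ler_pdivlMr //; move: h1; lra.
have q0 : 0 <= q by rewrite /q divr_ge0.
have P : drift e (dens s n - e) (dens s n) n s m s'.
  rewrite -[X in drift _ _ X](subrK e); apply: drift_of_bounds => // j /andP[nj jm].
  (* Up to [Gf m1] every slice modulo [Gf n] is [X], so the density is constant. Above, the slices
     modulo [Gf m1] have the old density or [q] times it, with [q >= 1 - e]. *)
  rewrite subrK dE; case: (leqP j m1) => jm1.
    have -> : dens s' j = rhoG j (addfs X (span2 o1 t) `&` Gf j)%fset.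
      rewrite /dens -capM1; congr (rho _ _ _); apply/fsetP => x; rewrite !inE -andbA.
      by case: (boolP (x \in Gf j)) => [/(Gf_mono jm1) ->|]; rewrite ?andbF.
    apply: (rho_coset_bounds gN (gG j) (Gf_mono nj) (Gf_mono jm1) r1) => y /fibX ->.
    by rewrite lexx andbT gerBl ltW.
  rewrite /dens sE.
  apply: (rho_coset_bounds gM1 (gG j) (Gf_mono (ltnW jm1)) (Gf_mono jm) r2) => y yY.
  have B1 : rhoG n X - e <= rhoG n X * q <= rhoG n X by apply/andP; split; nra.
  have [->|->|->] := fib_layer_cases gM1 tl2 X1M tM1 yY; rewrite ?rho_trfs ?rX1 //.
  by rewrite X2E rX2 lexx andbT gerBl ltW.
exists m, s', (n, t); split=> //.
- rewrite (densE st') sE (rho_layer R gM1 gM M1M tl2 X1M tM1) X2E rX1 rX2 dE.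
  have /andP[ w0 w1] := overlap_bounds R o2 z.
  move: (overlap _ _ _) ov w0 w1 => w ov w0 w1; clear - d0 d1 q0 q1 q2 ov w0 w1 c00.
  have : (1 - w) * q + w <= 1 - c0 / 3 by nra.
  by move: (rho _ _ _) d0 => d d0 h; rewrite mulrCA [d * _]mulrC -mulrDl ler_wpM2r.
- move=> p; rewrite mem_rcons inE => /orP[/eqP -> /=|/tg[pn p0]].
    by split=> //; apply: M1M.
  by split=> //; apply: NM.
- split.
    move=> p; rewrite mem_rcons inE => /orP[/eqP -> /=|pL].
      split; first by apply: ltnW; apply: ltn_trans m1m.
      rewrite sE; apply: le_trans (rho_bad_layer R gM1 gM M1M tl2 gN NM1 tM1 tM1 X1M _) _.
        by right.
      rewrite /rho ler_pdivrMr ?card_fin_gt0 // (coset_reps_card gN r1 NM1 gM1).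
      apply: le_trans (_ : ((#|` span2 o1 t| - #|` ssums o1|) * #|` Gf n|)%N%:R <= _).
        by rewrite ler_nat; apply: card_bad_tile.
      have /andP[h3 _] := card_span2 o1 t.
      by rewrite !natrM natrB // mulrA ler_wpM2r.
    have [pn hp] := ch p pL; have [tp _] := tg p pL.
    split; first by apply: leq_trans pn (ltnW (ltn_trans nm1 m1m)).
    have KM1 : {subset Gf p.1 <= Gf m1} by move=> x /(Gf_mono pn) /NM1.
    have LM : {subset bad (Gf p.1) p.2 (ssums s') <= Gf m}.
      apply: bad_sub => //; [by move=> x /KM1 /M1M|exact: NM|exact: state_sub].
    suff /andP[] : 0 <= rhoG m (bad (Gf p.1) p.2 (ssums s')) <= e by [].
    apply: (rho_fib_bounds gM1 gM M1M r2 LM) => y yY; rewrite rho_ge0 /=.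
    rewrite (fib_bad gM1) //; last exact: NM1.
    (* The bad set grows at most by the factor [|V|], while [Gf m1] is [|span2 o1 t|] times as large
       as [Gf n]. *)
    have key V : (#|` V| <= #|` span2 o1 t|)%N ->
        rhoG m1 (bad (Gf p.1) p.2 (addfs X V)) <= e.
      move=> hV; rewrite /rho ler_pdivrMr ?card_fin_gt0 // (coset_reps_card gN r1 NM1 gM1).
      have h := card_bad_addfs (Gf p.1) p.2 X V.
      apply: le_trans (_ : (#|` bad (Gf p.1) p.2 X| * #|` V|)%N%:R <= _).
        by rewrite ler_nat.
      move: hp; rewrite /rho ler_pdivrMr ?card_fin_gt0 // => hp.
      rewrite !natrM [X in _ <= _ * X]mulrC mulrA; apply: ler_pM => //.
      by rewrite ler_nat.
    have /andP[h3 _] := card_span2 o1 t.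
    rewrite sE; have [->|->|->] := fib_layer_cases gM1 tl2 X1M tM1 yY.
    - exact: key.
    - by rewrite /X1 trfs_addfsr; apply: key; rewrite card_trfs.
    by rewrite X2E; apply: key.
  rewrite pairwise_rcons pw andbT; apply/allP => p pL /=.
  by have [] := tg p pL.
have FN := tgt_sums_sub tg; set F := tgt_sums L in FN *.
have FM1 : {subset F <= Gf m1} by move=> x /FN /NM1.
(* The new target [t] turns [ssums o1] back into the full transversal [span2 o1 t], so the ideal
   outcome does not lose density. *)
have -> : tgt_sums (rcons L (n, t)) = (F `|` trfs t F)%fset.
  by rewrite /tgt_sums map_rcons ssums_rcons.
rewrite sE layer_addfs.
have -> : addfs X1 (F `|` trfs t F)%fset = addfs (addfs X F) (span2 o1 t).
  rewrite addfsU -trfs_addfsr trfs_addfsl -addfs_union X2E.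
  by rewrite -!addfsA [addfs (span2 _ _) _]addfsC.
have XFN : {subset addfs X F <= Gf n} by apply: addfs_sub_group.
rewrite -(rho_addfs_reps R gN gM1 NM1 r1 XFN).
apply: (rho_layer_ge R gM1 gM M1M tl2) => //; apply: addfs_sub_group => //.
  by move=> x /XFN /NM1.
by case: r1.
Qed.

(** Down-moves are iterated until the density is below [a + e]. Each starts from at least [a + e]
    and loses at most [e], so it stays at or above [a]; the factor [c < 1] bounds their number. *)
Lemma down_list e a lo hi : 0 < e -> 0 <= a -> lo <= a -> forall n s L,
  state n s -> targets n L -> chain e n (ssums s) L -> lo <= dens s n <= hi ->
  exists m s' L', [/\ drift e lo hi n s m s', dens s' m < a + e, targets m L',
    chain e m (ssums s') L' &
    rhoG n (addfs (ssums s) (tgt_sums L)) <= rhoG m (addfs (ssums s') (tgt_sums L'))].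
Proof.
move=> e0 a0 la; have [c /andP[c0 c1] Hdown] := down_once e0.
have main k n s L : state n s -> targets n L -> chain e n (ssums s) L ->
    lo <= dens s n <= hi -> c ^+ k * dens s n < a + e ->
    exists m s' L', [/\ drift e lo hi n s m s', dens s' m < a + e, targets m L',
    chain e m (ssums s') L' &
    rhoG n (addfs (ssums s) (tgt_sums L)) <= rhoG m (addfs (ssums s') (tgt_sums L'))].
  elim: k n s L => [|k IH] n s L st tg ch hd hk.
    rewrite expr0 mul1r in hk; exists n, s, L; split=> //.
    by apply: drift_refl => //; apply: ltW.
  have [h|h] := ltP (dens s n) (a + e).
    by exists n, s, L; split=> //; apply: drift_refl => //; apply: ltW.
  have [m [s' [p [P h1 tg' ch' hp]]]] := Hdown n s L st tg ch.
  have P' : drift e lo hi n s m s'.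
    by apply: drift_weaken P; [exact: lexx|lra|case/andP: hd].
  have hd' : lo <= dens s' m <= hi.
    by have [[nm _ _ _] bd _] := P'; apply: bd; rewrite nm leqnn.
  have [|m' [s'' [L' [P'' h2 tg'' ch'' hp']]]] := IH m s' _ (drift_state P') tg' ch' hd'.
    apply: le_lt_trans hk; rewrite exprSr -mulrA ler_wpM2l // exprn_ge0 //.
  exists m', s'', L'; split=> //; first exact: drift_trans P''.
  exact: le_trans hp'.
move=> n s L st tg ch hd.
have [h|h] := ltP (dens s n) (a + e).
  by exists n, s, L; split=> //; apply: drift_refl => //; apply: ltW.
have ae : 0 < a + e by lra.
have [k hk] : exists k, c ^+ k < a + e.
  have c1' : `|c| < 1 by rewrite ger0_norm.
  have := cvg_expr c1'; move=> /cvgrPdist_lt /(_ _ ae) [k _ /(_ k (leqnn k))].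
  by rewrite /= sub0r normrN => h'; exists k; apply: le_lt_trans h'; apply: ler_norm.
apply: (main k) => //; apply: le_lt_trans hk.
by have /andP[_ d1] := dens01 s n; rewrite ler_piMr // exprn_ge0.
Qed.

(** Adjoining a full transversal keeps the density; this forces strict progress along the filtration
    in every cycle. *)
Lemma plain_once e n s : 0 <= e -> state n s -> exists s',
  drift e (dens s n) (dens s n) n s n.+1 s'.
Proof.
move=> e0 st; have [us sN] := st; have NM := GS (i := n).
have [D [uD D0 r]] := coset_reps_fill (gG n) (gG n.+1) NM.
have [DM _ _ _] := r.
have XN := state_sub st.
have sE : ssums (s ++ D) = addfs (ssums s) (ssums D) by rewrite ssums_cat.
have st' : state n.+1 (s ++ D).
  split; last by move=> x; rewrite mem_cat => /orP[/sN/NM //|/mem_ssums /DM].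
  rewrite cat_uniq us uD andbT /=; apply/hasPn => d dD; apply: contraNN D0 => /sN dN.
  by rewrite -(coset_reps_eq0 r (mem_ssums dD) dN).
have ex : extends n s n.+1 (s ++ D).
  split=> //; first by move=> x xs; rewrite mem_cat xs.
  apply/fsetP => x; rewrite sE inE; apply/andP/idP => [[/addfsP[a [b [aX bD ->]]] abN]|xX].
    rewrite (coset_reps_eq0 r bD) ?addr0 //.
    by rewrite (fin_subgroupDl _ (gG n) (XN _ aX)) in abN.
  by rewrite XN //; split=> //; rewrite -[x]addr0; apply: mem_addfs => //; apply: ssums0.
have dE : dens (s ++ D) n.+1 = dens s n.
  by rewrite (densE st') sE (rho_addfs_reps R (gG n) (gG n.+1) NM r XN) densE.
have dE' : dens (s ++ D) n = dens s n by apply: extends_dens ex _.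
exists (s ++ D); split=> // j /andP[nj jm].
  have : (j == n) || (j == n.+1) by lia.
  by move=> /orP[] /eqP ->; rewrite ?dE ?dE' lexx.
have jn' : j = n by lia.
by rewrite jn' dE dE' subrr normr0.
Qed.

(* When [beta < 1] the density has to stay above [beta]: only the value it had at the
   start of a cycle, minus an arbitrarily small amount, can be recovered. *)
Definition near_top beta e n s :=
  beta - e <= dens s n <= beta + e /\ (beta < 1 -> beta < dens s n).

(** The descent to [alpha] keeps the ideal outcome at least as dense as the starting set, so
    up-moves can return arbitrarily close to the starting density. *)
Lemma down_up_cycle (alpha beta : R) e e' n s : 0 <= alpha -> alpha <= beta -> beta <= 1 ->
  0 < e' -> e' <= e -> state n s -> near_top beta e n s ->
  exists m s', [/\ (n < m)%N, drift (4 * e) (alpha - e) (beta + e) n s m s',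
    near_top beta e' m s' & exists2 j, (n <= j <= m)%N & dens s' j <= alpha + e].
Proof.
move=> alpha_ge0 alpha_le_beta beta_le1 e'0 ee st [/andP[t1 t2] t3].
pose h := e' / 4; have h0 : 0 < h by rewrite /h; lra.
have he : h * 4 = e' by rewrite /h; field.
have w4 : e <= 4 * e by lra.
have [s0 P0] := plain_once (ltW h0) st.
have st0 := drift_state P0; have d0E : dens s0 n.+1 = dens s n.
  have [[_ _ _ _] bd _] := P0.
  by apply/eqP; rewrite eq_le andbC; apply: bd; rewrite leqnSn leqnn.
have P0' : drift (4 * e) (alpha - e) (beta + e) n s n.+1 s0.
  by apply: drift_weaken P0; lra.
have tg0 : targets n.+1 [::] by [].
have ch0 : chain h n.+1 (ssums s0) [::] by split.
have hd0 : alpha - e <= dens s0 n.+1 <= beta + e by rewrite d0E; apply/andP; split; lra.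
have la : alpha - e <= alpha by lra.
have [m1 [s1 [L [P1 h1 tg1 ch1]]]] := down_list h0 alpha_ge0 la st0 tg0 ch0 hd0.
rewrite /tgt_sums /= addfs0 -(densE st0) d0E => hpot.
have P1' : drift (4 * e) (alpha - e) (beta + e) n s m1 s1.
  by apply: drift_trans P0' _; apply: drift_weaken P1; lra.
have st1 := drift_state P1; have [[nm1 _ _ _] bd1 _] := P1.
have hd1 : alpha - e <= dens s1 m1 <= beta + e by apply: bd1; rewrite nm1 leqnn.
have dn1 : dens s n <= 1 by have /andP[] := dens01 s n.
have fin m s' : drift (4 * e) (alpha - e) (beta + e) m1 s1 m s' -> near_top beta e' m s' ->
    exists m s', [/\ (n < m)%N, drift (4 * e) (alpha - e) (beta + e) n s m s',
    near_top beta e' m s' & exists2 j, (n <= j <= m)%N & dens s' j <= alpha + e].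
  move=> P nt; have [ex _ _] := P; have [mm _ _ _] := ex.
  exists m, s'; split=> //; first exact: leq_trans mm.
    exact: drift_trans P.
  exists m1; first by rewrite mm andbT ltnW.
  by rewrite (extends_dens ex) //; lra.
have ctl1 : ctl h m1 (ssums s1) L by right.
have P11 : drift (4 * e) (alpha - e) (beta + e) m1 s1 m1 s1.
  by apply: drift_refl => //; lra.
have [b1|b1] := ltP beta 1.
  have bd := t3 b1.
  (* [v] is strictly above [beta], strictly below [dens s n], which leaves room for the recovery
     error, and at most [beta + e' / 2], which leaves room for the overshoot [h]. *)
  pose v := beta + Num.min (dens s n - beta) e' / 2.
  have [mn1 mn2 mn0] : [/\ Num.min (dens s n - beta) e' <= dens s n - beta,
      Num.min (dens s n - beta) e' <= e' & 0 < Num.min (dens s n - beta) e'].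
    by rewrite ge_min lexx ge_min lexx orbT lt_min e'0 subr_gt0 bd.
  set w := Num.min _ _ in v mn1 mn2 mn0.
  have [hv|hv] := leP v (dens s1 m1).
    by apply: (fin m1 s1) => //; split; [apply/andP; split|]; move: hv; rewrite /v; lra.
  have dl0 : 0 < dens s n - v by rewrite /v; lra.
  have hd1' : alpha - e <= dens s1 m1 <= v + h.
    by case/andP: hd1 => -> _ /=; lra.
  have [m2 [s2 [P2 H2]]] := up_list (ltW h0) dn1 dl0 st1 tg1 ctl1 hpot hd1'.
  have hv2 : v <= dens s2 m2 by case: H2 => //; lra.
  have : alpha - e <= dens s2 m2 <= v + h.
    by have [[nm2 _ _ _] bd2 _] := P2; apply: bd2; rewrite nm2 leqnn.
  move=> /andP[_ hv3]; apply: (fin m2 s2).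
    by apply: drift_weaken P2; rewrite ?/v; lra.
  by split; [apply/andP; split|]; move: hv2 hv3; rewrite /v; lra.
have bE : beta = 1 by apply/eqP; rewrite eq_le beta_le1.
have [m2 [s2 [P2 hv2]]] : exists m2 s2,
    drift (4 * e) (alpha - e) (beta + e) m1 s1 m2 s2 /\ dens s n - e' <= dens s2 m2.
  have [hv|hv] := leP (dens s n - e') (dens s1 m1); first by exists m1, s1.
  have hd1' : alpha - e <= dens s1 m1 <= (dens s n - e') + h.
    by case/andP: hd1 => -> _ /=; lra.
  have [m2 [s2 [P2 H2]]] := up_list (ltW h0) dn1 e'0 st1 tg1 ctl1 hpot hd1'.
  exists m2, s2; split; last by case: H2.
  by apply: drift_weaken P2; lra.
have st2 := drift_state P2.
(* For [beta = 1] the density is now at least [1 - (e + e')], so the first condition of [ctl] allows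
   arbitrary targets: all nonzero elements of [Gf m2], whose subset sums fill [Gf m2]. *)
pose L2 := [seq (0%N, t) | t <- [seq t <- Gf m2 | t != 0]].
have tg2 : targets m2 L2.
  by move=> _ /mapP[t + ->] /=; rewrite mem_filter => /andP[t0 tG].
have e20 : 0 <= e + e' by lra.
have ct2 : ctl (e + e') m2 (ssums s2) L2 by left; rewrite -(densE st2); lra.
have hp2 : 1 <= rhoG m2 (addfs (ssums s2) (tgt_sums L2)).
  rewrite -(rho_self R (gG m2)); apply: rho_le => g gG2.
  rewrite -[g]add0r; apply: mem_addfs; first exact: ssums0.
  rewrite /tgt_sums -map_comp map_id; have [->|g0] := eqVneq g 0; first exact: ssums0.
  by apply: mem_ssums; rewrite mem_filter g0.
have hd2 : alpha - e <= dens s2 m2 <= 1 - e' + (e + e').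
  have /andP[_ d21] := dens01 s2 m2; apply/andP; split; last by lra.
  have [[nm2 _ _ _] bd2 _] := P2.
  by have /andP[] : alpha - e <= dens s2 m2 <= beta + e by apply: bd2; rewrite nm2 leqnn.
have [m3 [s3 [P3 H3]]] := up_list e20 (lexx 1) e'0 st2 tg2 ct2 hp2 hd2.
apply: (fin m3 s3).
  by apply: drift_trans P2 _; apply: drift_weaken P3; lra.
have /andP[_ d31] := dens01 s3 m3.
split; last by rewrite bE ltxx.
by apply/andP; split; case: H3; lra.
Qed.

End Filtration.

(** * Subsequential limits *)

Section SubsequentialLimits.
Variables (R : realType) (u : nat -> R) (alpha beta : R).

Definition oscillates :=
  [/\ forall e, 0 < e -> exists N, forall j, (N <= j)%N -> `|u j.+1 - u j| <= e,
      forall e, 0 < e -> exists N, forall j, (N <= j)%N -> alpha - e <= u j <= beta + e,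
      forall e N, 0 < e -> exists2 j, (N <= j)%N & u j <= alpha + e &
      forall e N, 0 < e -> exists2 j, (N <= j)%N & beta - e <= u j].

(** Discrete intermediate value argument: after an index with value at most [alpha + e], the first
    index with value at least [c - e] cannot overshoot, as the steps are at most [e]. *)
Lemma oscillates_near c e N : oscillates -> 0 < e -> alpha <= c <= beta ->
  exists2 j, (N <= j)%N & `|u j - c| <= e.
Proof.
move=> [small _ low high] e0 /andP[ac cb].
have [N1 HN1] := small e e0.
have [j0 Nj0 lj0] := low e (maxn N N1) e0.
have [j1 j01 hj1] := high e j0 e0.
have ex : exists j, (j0 <= j)%N && (c - e <= u j).
  by exists j1; rewrite j01 (le_trans _ hj1) // lerD2r.
case: (ex_minnP ex) => j /andP[j0j cj] jmin.
have Nj : (maxn N N1 <= j)%N by apply: leq_trans j0j.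
rewrite geq_max in Nj; have /andP[Nj1 _] := Nj.
exists j => //; rewrite ler_distl cj /=.
have [E|] := eqVneq j0 j; first by rewrite -E; lra.
move=> ne; case: j j0j cj jmin Nj Nj1 ne => [|j] j0j cj jmin Nj Nj1 ne; first by lia.
have j0j' : (j0 <= j)%N by lia.
have ltj : u j < c - e.
  rewrite ltNge; apply/negP => h; have := jmin j; rewrite j0j' h => /(_ isT).
  by rewrite ltnn.
have : `|u j.+1 - u j| <= e by apply: HN1; move: j0j' Nj0; rewrite geq_max; lia.
by rewrite ler_distl => /andP[_]; lra.
Qed.

Lemma oscillates_limits : oscillates ->
  [set c : R | exists phi : nat -> nat, {homo phi : m n / (m < n)%N} /\
    u (phi l) @[l --> \oo] --> c] = `[alpha, beta]%classic.
Proof.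
move=> osc; apply/seteqP; split=> c /=.
  move=> [phi [hphi cv]]; have [_ bnd _ _] := osc.
  have phige l : (l <= phi l)%N.
    by elim: l => // l IH; apply: leq_ltn_trans IH _; apply: hphi.
  have key e : 0 < e -> alpha - 2 * e <= c <= beta + 2 * e.
    move=> e0; have [N HN] := bnd e e0.
    move/cvgrPdist_le: cv => /(_ e e0) [N' _ /(_ (maxn N N'))] /=.
    rewrite leq_maxr => /(_ isT); rewrite ler_distl => /andP[h1 h2].
    have /HN/andP[h3 h4] : (N <= phi (maxn N N'))%N.
      by apply: leq_trans (phige _); rewrite leq_maxl.
    by apply/andP; split; lra.
  rewrite in_itv /=; apply/andP; split; apply/ler_addgt0Pr => e e0.
    have e20 : 0 < e / 2 by lra.
    by have /andP[] := key _ e20; lra.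
  have e20 : 0 < e / 2 by lra.
  by have /andP[] := key _ e20; lra.
rewrite in_itv /= => cab.
have inv0 k : 0 < k.+1%:R^-1 :> R by rewrite invr_gt0 ltr0n.
pose g N k := xget 0%N [set j | (N <= j)%N /\ `|u j - c| <= k.+1%:R^-1].
have gP N k : (N <= g N k)%N /\ `|u (g N k) - c| <= k.+1%:R^-1.
  rewrite /g; case: xgetP => [j _ //|/=].
  by have [j h1 h2] := oscillates_near N osc (inv0 k) cab => /(_ j) [].
pose phi := fix phi k := if k is k'.+1 then g (phi k').+1 k else g 0%N 0%N.
exists phi; split.
  by apply: homo_ltn => [? ? ?|k]; [apply: ltn_trans|case: (gP (phi k).+1 k.+1)].
have phiP k : `|u (phi k) - c| <= k.+1%:R^-1.
  by case: k => [|k]; [case: (gP 0%N 0%N)|case: (gP (phi k).+1 k.+1)].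
apply/cvgrPdist_le => e e0.
have /cvgrPdist_le/(_ e e0) [N _ HN] := @cvg_harmonic R.
exists N => // l Nl; rewrite distrC; apply: le_trans (phiP l) _.
have := HN l Nl; rewrite /= sub0r normrN; apply: le_trans; exact: ler_norm.
Qed.

End SubsequentialLimits.

(** * Subset sums of a list as sums over finite sets *)

Section SubsetSums.
Variable G : zmodType.
Implicit Types (s r : seq G) (x : G).

Lemma mem_ssums_sum r : uniq r -> \sum_(a <- r) a \in ssums r.
Proof.
elim: r => [|x r IH] /=; first by rewrite big_nil inE.
move=> /andP[_ ur]; rewrite big_cons inE mem_trfs; apply/orP; right.
by rewrite addrC addKr IH.
Qed.

Lemma ssumsP s x : uniq s ->
  (x \in ssums s) <-> exists F : {fset G}, {subset F <= s} /\ x = \sum_(a <- F) a.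
Proof.
move=> us; split; last first.
  move=> [F [Fs ->]]; have p : perm_eq s (F ++ [seq x <- s | x \notin F]).
    apply: uniq_perm => //.
      rewrite cat_uniq fset_uniq filter_uniq // andbT /=; apply/hasPn => y.
      by rewrite mem_filter => /andP[].
    move=> y; rewrite mem_cat mem_filter; case: (boolP (y \in F)) => //= yF.
    by rewrite Fs.
  rewrite (perm_ssums p) ssums_cat -[X in X \in _]addr0; apply: mem_addfs.
    by apply: mem_ssums_sum; apply: fset_uniq.
  exact: ssums0.
elim: s x us => [|y s IH] x /=.
  by move=> _; rewrite inE => /eqP ->; exists fset0; rewrite big_seq_fset0.
move=> /andP[ys us]; rewrite inE => /orP[/(IH _ us)[F [Fs ->]]|].
  by exists F; split=> // a /Fs; rewrite inE => ->; rewrite orbT.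
rewrite mem_trfs => /(IH _ us)[F [Fs E]]; exists (y |` F)%fset; split.
  by move=> a; rewrite !inE => /orP[->|/Fs ->]; rewrite ?orbT.
rewrite big_fsetU1 /=; last by apply: contraNN ys => /Fs.
by rewrite -E addrC subrK.
Qed.

End SubsetSums.

(** * Chaining infinitely many cycles *)

Section Construction.
Variables (R : realType) (G : zmodType) (Gf : nat -> {fset G}) (alpha beta : R).

Hypothesis gG : forall i, fin_subgroup (Gf i).
Hypothesis GS : forall i, {subset Gf i <= Gf i.+1}.
Hypothesis Gcov : forall x, exists i, x \in Gf i.
Hypothesis dich : unbounded_orders G \/ complemented_cycles G.

(** The k-th cycle uses the tolerance [eps k], which tends to 0, and [A] is the union of all lists.
    As [j <= n j], the list [s j] already determines the density in [Gf j]. *)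
Lemma construction : 0 <= alpha -> alpha <= beta -> beta <= 1 ->
  exists (A : set G) (u : nat -> R), oscillates u alpha beta /\
    forall j, exists X : {fset G}, u j = rho R (Gf j) X /\
      forall x, (x \in X) = (x \in Gf j) && `[< subset_sums A x >].
Proof.
move=> a0 ab b1.
pose eps k : R := k.+1%:R^-1.
have eps0 k : 0 < eps k by rewrite invr_gt0 ltr0n.
have epsS k l : (k <= l)%N -> eps l <= eps k by move=> kl; rewrite lef_pV2 ?posrE ?ltr0n // ler_nat.
pose good k (p : nat * seq G) := state Gf p.1 p.2 /\ near_top Gf beta (eps k) p.1 p.2.
pose next k (p p' : nat * seq G) := [/\ (p.1 < p'.1)%N,
  drift Gf (4 * eps k) (alpha - eps k) (beta + eps k) p.1 p.2 p'.1 p'.2,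
  good k.+1 p' &
  exists2 j, (p.1 <= j <= p'.1)%N & dens R Gf p'.2 j <= alpha + eps k].
have nextP k p : good k p -> exists p', next k p p'.
  move=> [st nt].
  have [m [s' [h1 h2 h3 h4]]] :=
    down_up_cycle gG GS Gcov dich a0 ab b1 (eps0 k.+1) (epsS k k.+1 (leqnSn k)) st nt.
  by exists (m, s'); split=> //; split=> //; apply: drift_state h2.
(* The start is all of [Gf 0], whose density 1 is within [eps 0 = 1] of [beta]. The default of
   [xget] is never taken, since every good pair has a successor. *)
pose sg := fix sg k := if k is k'.+1 then xget (0%N, [::]) (next k' (sg k'))
                       else (0%N, (Gf 0 : seq G)).
have good0 : good 0%N (sg 0%N).
  have st : state Gf 0%N (Gf 0%N) by split; [apply: fset_uniq|].
  split=> //; have -> : near_top Gf beta (eps 0) (sg 0).1 (sg 0).2 =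
      (beta - eps 0 <= 1 <= beta + eps 0 /\ (beta < 1 -> beta < 1)).
    rewrite /near_top /= densE // (_ : ssums (Gf 0%N) = Gf 0%N) ?rho_self //.
    apply/fsetP => x; apply/idP/idP => [|/mem_ssums //].
    exact: state_sub.
  split=> //; rewrite /eps invr1; apply/andP; split; lra.
have sgP k : good k (sg k) /\ next k (sg k) (sg k.+1).
  elim: k => [|k [_ [_ _ h _]]].
    by split=> //=; apply: xgetPex; apply: nextP.
  by split=> //; apply: xgetPex; apply: nextP.
pose n k := (sg k).1; pose s k := (sg k).2.
have nlt k : (n k < n k.+1)%N by have [_ []] := sgP k.
have nge k : (k <= n k)%N by elim: k => // k IH; apply: leq_ltn_trans (nlt k).
have nmono : {homo n : k l / (k <= l)%N}.
  by apply: homo_leq leqnn leq_trans _ => i; apply: ltnW.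
have ext k : extends Gf (n k) (s k) (n k.+1) (s k.+1) by have [_ [_ []]] := sgP k.
have us k : uniq (s k) by have [[[]]] := sgP k.
have ssub k l : (k <= l)%N -> {subset s k <= s l}.
  move=> /subnKC <-; elim: (l - k)%N => [|i IH] x; first by rewrite addn0.
  by move=> /IH; rewrite addnS; case: (ext (k + i)%N) => _ _ h _; apply: h.
(* From stage [k] on, the trace of the subset sums in [Gf (n k)] is frozen. *)
have cap k l : (k <= l)%N -> (ssums (s l) `&` Gf (n k))%fset = (ssums (s k) `&` Gf (n k))%fset.
  move=> /subnKC <-; elim: (l - k)%N => [|i IH]; first by rewrite addn0.
  rewrite addnS -IH; have [_ _ _ <-] := ext (k + i)%N.
  apply/fsetP => x; rewrite !inE; case: (boolP (x \in Gf (n k))) => xk; rewrite ?andbF //.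
  by rewrite (Gf_mono GS (nmono _ _ (leq_addr i k)) xk) !andbT.
pose A : set G := [set x | exists k, x \in s k].
pose u j : R := dens R Gf (s j) j.
have capj k j : (j <= n k)%N -> forall x,
    (x \in (ssums (s k) `&` Gf j)%fset) = (x \in Gf j) && `[< subset_sums A x >].
  move=> jn x; rewrite inE andbC; case: (boolP (x \in Gf j)) => //= xj.
  apply/idP/asboolP => [/(ssumsP _ (us k))[F [Fs E]]|[F [FA E]]].
    by exists F; split=> // a /= /Fs ak; exists k.
  have [l kl Fl] : exists2 l, (k <= l)%N & {subset (F : seq G) <= s l}.
    have : {subset (F : seq G) <= A} by move=> a aF; rewrite inE; apply: FA.
    elim: (F : seq G) => [|a r IH] rA; first by exists k => // b; rewrite in_nil.
    have [|l kl rl] := IH; first by move=> b br; apply: rA; rewrite inE br orbT.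
    have : a \in A by apply: rA; rewrite inE eqxx.
    rewrite inE => -[l' al']; exists (maxn l l'); first by rewrite leq_max kl.
    move=> b; rewrite inE => /orP[/eqP ->|/rl]; first by apply: ssub al'; rewrite leq_maxr.
    by apply: ssub; rewrite leq_maxl.
  have xl : x \in ssums (s l) by apply/(ssumsP _ (us l)); exists F.
  have : x \in (ssums (s l) `&` Gf (n k))%fset by rewrite inE xl (Gf_mono GS jn xj).
  by rewrite (cap _ _ kl) inE => /andP[].
have uE k j : (j <= n k)%N -> u j = dens R Gf (s k) j.
  move=> jk; rewrite /u /dens; congr (rho _ _ _); apply/fsetP => x.
  by rewrite (capj _ _ jk) (capj _ _ (nge j)).
have loc j k : (n k <= j)%N -> exists2 l, (k <= l)%N & (n l <= j < n l.+1)%N.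
  move=> kj; have ex : exists i, (j < n i)%N by exists j.+1; apply: nge.
  case: (ex_minnP ex) => -[|l] jl lmin.
    by have := leq_trans jl (nmono 0%N k isT); lia.
  have lj : (n l <= j)%N by rewrite leqNgt; apply/negP => /lmin; rewrite ltnn.
  exists l; last by rewrite lj.
  rewrite leqNgt; apply/negP => lk; have := nmono _ _ lk; lia.
have epsx e : 0 < e -> exists k, forall l, (k <= l)%N -> 4 * eps l <= e.
  move=> e0; have e40 : 0 < e / 4 by lra.
  have /cvgrPdist_le/(_ _ e40) [N _ HN] := @cvg_harmonic R.
  exists N => l Nl; have := HN l Nl; rewrite /= sub0r normrN ger0_norm ?invr_ge0 //.
  by rewrite -/(eps l); lra.
have st1 k j : (n k <= j <= n k.+1)%N -> alpha - eps k <= u j <= beta + eps k.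
  move=> /[dup] h /andP[_ jn]; rewrite (uE k.+1) //.
  by have [_ [_ [_ bd _] _ _]] := sgP k; apply: bd.
exists A, u; split; last first.
  move=> j; exists (ssums (s j) `&` Gf j)%fset; split=> //.
  by apply: capj; apply: nge.
split.
- move=> e /epsx[k kP]; exists (n k) => j /loc[l kl /andP[lj jl]].
  rewrite !(uE l.+1) ?(ltnW jl) //; apply: le_trans (kP _ kl).
  by have [_ [_ [_ _ df] _ _]] := sgP l; apply: df; rewrite lj.
- move=> e /epsx[k kP]; exists (n k) => j /loc[l kl /andP[lj jl]].
  have := kP _ kl; have := eps0 l.
  have /andP[] : alpha - eps l <= u j <= beta + eps l by apply: st1; rewrite lj ltnW.
  by move=> *; apply/andP; split; lra.
- move=> e N /epsx[k kP]; pose l := maxn N k.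
  have [_ [_ _ _ [j /andP[lj jl] hj]]] := sgP l.
  exists j; first by apply: leq_trans lj; apply: leq_trans (nge _); rewrite leq_maxl.
  rewrite (uE l.+1) //; apply: le_trans hj _.
  by have := kP l (leq_maxr _ _); have := eps0 l; lra.
move=> e N /epsx[k kP]; pose l := maxn N k.
have [[_ [/andP[h _] _]] _] := sgP l.
exists (n l); first by apply: leq_trans (nge _); rewrite leq_maxl.
rewrite (uE l) //; apply: le_trans h.
by have := kP l (leq_maxr _ _); have := eps0 l; lra.
Qed.

End Construction.

Theorem theorem1p3 (R : realType) (G : zmodType)
    (G_countable : countable [set: G])
    (G_locally_finite : locally_finite_group G)
    (twoG_infinite : infinite_set [set g *+ 2 | g in [set: G]])
    (H : nat -> set G) (H_filtration : finite_filtration H)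
    (alpha beta : R) (alpha_ge0 : 0 <= alpha) (alpha_le_beta : alpha <= beta)
    (beta_le1 : beta <= 1) :
  exists A : set G,
    limit_densities R H A = `[alpha, beta]%classic.
Proof.
have [subH finH incH covH] := H_filtration.
pose Gf i := fset_set (H i).
have memGf i x : (x \in Gf i) = `[< H i x >] by rewrite in_fset_set.
have gG i : fin_subgroup (Gf i).
  have [H0 HB] := subH i; split.
    by rewrite memGf; apply/asboolP; move: H0; rewrite inE.
  move=> x y; rewrite !memGf => /asboolP xH /asboolP yH; apply/asboolP.
  by have := HB x y; rewrite !inE; apply.
have GS i : {subset Gf i <= Gf i.+1}.
  by move=> x; rewrite !memGf => /asboolP/incH xH; apply/asboolP.
have Gcov x : exists i, x \in Gf i.
  have : (\bigcup_i H i) x by rewrite covH.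
  by move=> [i _ xH]; exists i; rewrite memGf; apply/asboolP.
have dich : unbounded_orders G \/ complemented_cycles G.
  apply: orders_dichotomy => [g|A].
    by have [i gi] := Gcov g; exists (Gf i).
  apply: contrapT => hA; apply: twoG_infinite.
  apply: (@sub_finite_set _ _ [set` A]); last exact: finite_fset.
  move=> _ [g _ <-] /=; apply: contrapT => /negP gA; apply: hA; by exists g.
have [A [u [osc uE]]] := construction gG GS Gcov dich alpha_ge0 alpha_le_beta beta_le1.
exists A; rewrite -(oscillates_limits osc).
have E : rel_density R H (subset_sums A) = u.
  apply/funext => j; have [X [-> XE]] := uE j.
  rewrite /rel_density /rho; congr (#|` _|%:R / _); apply/fsetP => x.
  rewrite XE memGf in_fset_set; last exact: finite_setIr.
  apply/idP/andP => [|[/asboolP h1 /asboolP h2]]; last by rewrite inE.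
  by rewrite inE => -[h1 h2]; split; apply/asboolP.
rewrite /limit_densities E; apply/seteqP; split=> c /=; first by case.
(* The range condition on [c] follows from membership in the interval between [alpha] and [beta]. *)
move=> hc; split=> //.
have : `[alpha, beta]%classic c by rewrite -(oscillates_limits osc).
rewrite /= in_itv /= => /andP[h1 h2]; apply/andP; split; first exact: le_trans h1.
exact: le_trans beta_le1.
Qed.
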